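(* Consider the system $\dot x=Lx+N(x)$ in $\mathbb{R}^n$, where $L$ is a real $n\times n$ matrix, $N\in C^\infty$, $N(0)=0$ and $N_x(0)=0$. Assume that all the eigenvalues of $L$ are real and negative, and let $-\wedge_1>-\wedge_2>\dots>-\wedge_m$ be the distinct eigenvalues. Let $x(t)=(x_1(t),\dots,x_n(t))$ be a solution with $x(t)\to0$ as $t\to+\infty$. Then for any $\Theta>0$ and any $s=1,\dots,n$ one can find polynomials $c^\chi_s(t)$, $\chi\in I_\Theta$, such that $$x_s(t)=\sum_{\chi\in I_\Theta}c^\chi_s(t)\,e^{-(\chi_1\wedge_1+\dots+\chi_m\wedge_m)t}+o(e^{-\Theta t})\qquad\text{as }t\to+\infty,\quad \chi=(\chi_1,\dots,\chi_m).$$ Moreover, writing $c^\chi(t)=(c^\chi_1(t),\dots,c^\chi_n(t))$ and denoting by $d_i(t)$ the vector $c^\chi(t)$ for $\chi$ with $\chi_i=1$ and $\chi_j=0$ for $j\ne i$, the vectors of polynomials $d_i(t)$ depend only on $x(0)$, and the vectors of polynomials $c^\chi(t)$ with $|\chi|:=\sum_j\chi_j>1$ are determined by the $d_i(t)$. Further, if $\chi_j=0$ for $j\ge i+1$, then $c^\chi(t)$ is determined by $d_1,\dots,d_i$.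
   Context: $I_\Theta=\{\chi=(\chi_1,\dots,\chi_m)\in\mathbb{N}^m:\chi_1\wedge_1+\dots+\chi_m\wedge_m\le\Theta\}$, where $\mathbb{N}=\{0,1,2,\dots\}$. $N_x$ denotes the Jacobian matrix of $N$. The notation $h(t)=o(e^{-\Theta t})$ means $h(t)e^{\Theta t}\to0$ as $t\to+\infty$. *)

(* Defs.v *)
From HB Require Import structures.
From mathcomp Require Import all_boot all_order all_algebra.
From mathcomp Require Import complex.
From mathcomp Require Import all_classical all_reals all_analysis.

Set Implicit Arguments.
Unset Strict Implicit.
Unset Printing Implicit Defensive.

Import Order.TTheory GRing.Theory Num.Theory.
Import numFieldNormedType.Exports.

Local Open Scope classical_set_scope.
Local Open Scope ring_scope.

(* Points of R^n are row vectors, as in the library's Jacobian ['J f p]; the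
   matrix L therefore acts on x as [x *m L^T]. *)

(* C^k on the whole of R^p: all iterated partial derivatives of order at most k
   exist and are continuous. *)
Fixpoint Ck (R : realType) (p q : nat) (k : nat) (f : 'rV[R]_p -> 'rV[R]_q)
    {struct k} : Prop :=
  continuous f /\
  (if k is k'.+1 then
     forall j : 'I_p, (forall a, derivable f a (delta_mx 0 j)) /\
                      Ck k' (fun a => 'D_(delta_mx 0 j) f a)
   else True).

Definition smooth (R : realType) (p q : nat) (f : 'rV[R]_p -> 'rV[R]_q) : Prop :=
  forall k, Ck k f.

(* At t = 0 only right-continuity is required: together with the equation for
   t > 0 this is the same as asking for the equation on [0, +oo[ with a
   one-sided derivative at 0, and nothing is assumed about t < 0. *)
Definition solution (R : realType) (n : nat) (f : 'rV[R]_n -> 'rV[R]_n)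
    (x : R -> 'rV[R]_n) : Prop :=
  {within `[0, +oo[, continuous x} /\
  forall t : R, 0 < t -> is_derive t 1 x (f (x t)).

Definition decaying_solution (R : realType) (n : nat) (L : 'M[R]_n)
    (N : 'rV[R]_n -> 'rV[R]_n) (x : R -> 'rV[R]_n) : Prop :=
  solution (fun a => a *m L^T + N a) x /\ x t @[t --> +oo] --> (0 : 'rV[R]_n).

Notation multi_index m := {ffun 'I_m -> nat}.

Definition mi_size (m : nat) (chi : multi_index m) : nat :=
  (\sum_(j < m) chi j)%N.

Definition mi_unit (m : nat) (i : 'I_m) : multi_index m :=
  [ffun j => (j == i : nat)].

Definition mi_dot (R : realType) (m : nat) (lam : 'I_m -> R)
    (chi : multi_index m) : R :=
  \sum_(j < m) (chi j)%:R * lam j.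

(* Finite as soon as every [lam j] is positive, so that the finitely
   supported sums [\sum_(chi \in I_ lam Theta) _] are genuine sums. *)
Definition I_ (R : realType) (m : nat) (lam : 'I_m -> R) (Theta : R) :
    set (multi_index m) :=
  [set chi | mi_dot lam chi <= Theta].

Lemma finite_I_ (R : realType) (m : nat) (lam : 'I_m -> R) (Theta : R) :
  (forall j, 0 < lam j) -> finite_set (I_ lam Theta).
Proof.
move=> lam0; pose B := (\max_j Num.truncn (Theta / lam j)).+1.
pose g (f : {ffun 'I_m -> 'I_B}) : multi_index m :=
  [ffun j => nat_of_ord (f j)].
apply: (@sub_finite_set _ _ (g @` setT)); last first.
  by apply: finite_image; exact: finite_finset.
move=> chi chiT; have chiB j : (chi j < B)%N.
  rewrite ltnS (leq_trans _ (leq_bigmax j)) // truncn_ge_nat.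
    rewrite ler_pdivlMr //; apply: le_trans chiT.
    rewrite /mi_dot (bigD1 j) //= lerDl sumr_ge0 // => k _.
    by rewrite mulr_ge0 // ltW.
  rewrite divr_ge0 ?(ltW (lam0 j)) //; apply: le_trans chiT.
  by rewrite /mi_dot sumr_ge0 // => k _; rewrite mulr_ge0 // ltW.
by exists [ffun j => Ordinal (chiB j)] => //; apply/ffunP => j; rewrite !ffunE.
Qed.

Definition o_exp (R : realType) (Theta : R) (h : R -> R) : Prop :=
  h t * expR (Theta * t) @[t --> +oo] --> (0 : R).

(* Main.v *)
Require Import Defs.
From mathcomp Require Import all_boot all_order all_algebra.
From mathcomp Require Import complex.
From mathcomp Require Import all_classical all_reals all_analysis.
From mathcomp Require Import ring lra.

Set Implicit Arguments.
Unset Strict Implicit.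
Unset Printing Implicit Defensive.

Import Order.TTheory GRing.Theory Num.Theory.
Import numFieldNormedType.Exports.

Local Open Scope classical_set_scope.
Local Open Scope ring_scope.

(** Write A = L^T and z_i = exp(- lam_i t).

    Formal side. Substituting a series sum_chi c^chi(t) z^chi with polynomial
    coefficients into x' = x A + N(x) gives one equation for each multi-index,
      (c^chi)' = c^chi (A + chi.lam) + F_chi,
    and since N has neither constant nor linear part, F_chi only involves the
    c^chi' with chi' < chi. The operator c |-> c' - c (A + mu) is onto on
    polynomial vectors, because the characteristic polynomial of A splits over
    the reals ([pderiv_sub_surj]). After a right inverse has been chosen once
    and for all, the coefficients with |chi| > 1 are functions of the
    d_i, the coefficients at the unit multi-indices, which are subject to
    d_i' = d_i (A + lam_i) alone, and c^chi only depends on the d_i with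
    chi_i > 0 ([formal_solution_supp]). That is what the last two clauses say.
    Resonances chi.lam = lam_i are harmless: chi and the i-th unit multi-index
    remain different labels for the same exponential.

    Analytic side. It remains to find, for a given decaying solution x, a
    family d whose formal series is asymptotic to x. A quadratic Lyapunov form
    shows that x decays at some rate a > 0 ([exponential_decay]), which may be
    taken to be at most every lam_i. Suppose that
    x agrees with the truncated series up to order theta. As N is flat at 0,
    the difference u then solves u' = u A + h with h of order theta + a, hence
      u = sum_i e_i(t) exp(- lam_i t) up to order theta + a,
    where e_i(t) exp(- lam_i t) solves the linear equation and e_i = 0 when
    lam_i < theta ([linear_asymptotics]). Replacing d by d + e absorbs u; it
    changes the other coefficients only at multi-indices of weight at least
    theta + a, so x agrees with the new series up to order theta + a
    ([bootstrap_step]). Beyond the largest lam_i nothing changes any more, and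
    the same d serves all orders ([bootstrap]).

    Dependence on x(0). Two solutions with the same initial value coincide on
    [0, +oo[ ([solution_unique]), so d can be chosen as a function of x(0). *)

Local Notation "M ^P" := (map_mx (@polyC _) M) (at level 2, format "M ^P").

(** * Exponential orders of smallness *)

(** The slack between r and theta absorbs constants and polynomials, so the
    bound carries no constant and multiplying by a polynomial costs nothing. *)
Definition exp_small (R : realType) (theta : R) (h : R -> R) : Prop :=
  forall r, r < theta -> \forall t \near +oo, `|h t| <= expR (- r * t).

Section ExpSmall.
Context {R : realType}.
Implicit Types (theta r : R) (f g h : R -> R).

Lemma near_pinftyP (P : R -> Prop) :
  (\forall t \near +oo, P t) <-> exists T, 0 < T /\ forall t, T <= t -> P t.
Proof.
split=> [[T [_ TP]]|[T [T0 TP]]].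
  exists (Num.max T 0 + 1); split; first by rewrite ltr_wpDl // le_max lexx orbT.
  move=> t Tt; apply: TP; rewrite (lt_le_trans _ Tt) //.
  by rewrite ltr_pwDr // le_max lexx.
by exists T; split; [rewrite num_real|move=> t /ltW/TP].
Qed.

Lemma exp_small_le theta theta' h : theta' <= theta ->
  exp_small theta h -> exp_small theta' h.
Proof. by move=> le_th hs r /lt_le_trans/(_ le_th)/hs. Qed.

Lemma exp_small_dom theta f g :
  (\forall t \near +oo, `|f t| <= `|g t|) -> exp_small theta g -> exp_small theta f.
Proof.
move=> fg gs r /gs rg; near=> t; apply: le_trans (_ : `|g t| <= _); by near: t.
Unshelve. all: by end_near. Qed.

Lemma exp_small_eq theta f g :
  (forall t, 0 < t -> f t = g t) -> exp_small theta g -> exp_small theta f.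
Proof.
move=> fg; apply: exp_small_dom; near=> t.
have t0 : 0 < t by near: t; exact: nbhs_pinfty_gt.
by rewrite fg.
Unshelve. all: by end_near. Qed.

Lemma exp_small_ext theta f g : f =1 g -> exp_small theta g -> exp_small theta f.
Proof. by move=> fg; apply: exp_small_eq => t _. Qed.

Lemma exp_smallM theta theta' f g : exp_small theta f -> exp_small theta' g ->
  exp_small (theta + theta') (fun t => f t * g t).
Proof.
move=> fs gs r rlt; pose d := (theta + theta' - r) / 2.
have d0 : 0 < d by rewrite divr_gt0 // subr_gt0.
have /fs fd : theta - d < theta by rewrite ltrBlDr ltrDl.
have /gs gd : theta' - d < theta' by rewrite ltrBlDr ltrDl.
near=> t; rewrite normrM.
have -> : - r * t = - (theta - d) * t + - (theta' - d) * t.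
  by rewrite -mulrDl; congr (_ * _); rewrite /d; lra.
by rewrite expRD; apply: ler_pM => //; near: t.
Unshelve. all: by end_near. Qed.

Lemma exp_small_cst (c : R) : exp_small 0 (cst c).
Proof.
move=> r r0; near=> t; apply: le_trans (expR_ge1Dx _).
rewrite /cst -lerBlDl mulrC -ler_pdivrMr ?oppr_gt0 //.
Unshelve. all: by end_near. Qed.

Lemma exp_small0 theta : exp_small theta (cst 0).
Proof. by move=> r _; near=> t; rewrite normr0 expR_ge0. Unshelve. all: by end_near. Qed.

Lemma exp_smallZ theta (c : R) f : exp_small theta f ->
  exp_small theta (fun t => c * f t).
Proof.
by move=> fs; rewrite -[theta]add0r; apply: exp_smallM => //; exact: exp_small_cst.
Qed.

Lemma exp_smallN theta f : exp_small theta f -> exp_small theta (fun t => - f t).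
Proof. by apply: exp_small_dom; near=> t; rewrite normrN. Unshelve. all: by end_near. Qed.

Lemma exp_smallD theta f g : exp_small theta f -> exp_small theta g ->
  exp_small theta (fun t => f t + g t).
Proof.
move=> fs gs r rlt; pose r' := (r + theta) / 2.
have rr' : r' < theta by rewrite /r'; lra.
have fr := fs _ rr'; have gr := gs _ rr'.
(* the factor 2 is paid for by the room between r and r' *)
have cr : r - r' < 0 by rewrite /r'; lra.
have := @exp_small_cst 2 _ cr; rewrite /cst => c2; near=> t.
apply: (le_trans (ler_normD _ _)); apply: (@le_trans _ _ (2 * expR (- r' * t))).
  by rewrite mulr_natl mulr2n; apply: lerD; near: t.
have -> : - r * t = - (r - r') * t + - r' * t by ring.
rewrite expRD ler_wpM2r ?expR_ge0 //.
have : `|2| <= expR (- (r - r') * t) by near: t.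
by rewrite ger0_norm.
Unshelve. all: by end_near. Qed.

Lemma exp_smallB theta f g : exp_small theta f -> exp_small theta g ->
  exp_small theta (fun t => f t - g t).
Proof. by move=> fs gs; apply: exp_smallD => //; exact: exp_smallN. Qed.

Lemma exp_small_sum theta (I : Type) (s : seq I) (P : pred I) (F : I -> R -> R) :
  (forall i, P i -> exp_small theta (F i)) ->
  exp_small theta (fun t => \sum_(i <- s | P i) F i t).
Proof.
move=> Fs; elim: s => [|i s IHs].
  by apply: (@exp_small_ext _ _ (cst 0)) (@exp_small0 _) => t; rewrite big_nil.
have [Pi|nPi] := boolP (P i).
  have := exp_smallD (Fs i Pi) IHs.
  by apply: exp_small_ext => t; rewrite big_cons Pi.
by apply: exp_small_ext IHs => t; rewrite big_cons (negPf nPi).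
Qed.

Lemma exp_small_expR (mu : R) : exp_small mu (fun t => expR (- mu * t)).
Proof.
move=> r rmu; near=> t; rewrite ger0_norm ?expR_ge0 // ler_expR ler_wpM2r ?lerN2 ?(ltW rmu) //.
Unshelve. all: by end_near. Qed.

Lemma exp_small_horner (p : {poly R}) : exp_small 0 (horner p).
Proof.
elim/poly_ind: p => [|p c IHp].
  by apply: exp_small_ext (exp_small_cst 0) => t; rewrite horner0.
have idS : exp_small 0 (id : R -> R).
  move=> r r0; have r20 : r / 2 < 0 by lra.
  have := @exp_small_cst (- (r / 2))^-1 _ r20; rewrite /cst => c2.
  near=> t; have t0 : 0 < t.
    by near: t; exact: nbhs_pinfty_gt.
  rewrite ger0_norm ?(ltW t0) //.
  have -> : - r * t = - (r / 2) * t + - (r / 2) * t by field.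
  rewrite expRD; apply: (@le_trans _ _ ((- (r / 2))^-1 * expR (- (r / 2) * t))).
    rewrite mulrC ler_pdivlMr ?oppr_gt0 // mulrC.
    by apply: le_trans (expR_ge1Dx _); rewrite lerDr.
  rewrite ler_wpM2r ?expR_ge0 //; apply: le_trans (ler_norm _) _; by near: t.
apply: (@exp_small_ext _ _ (fun t => p.[t] * t + c)).
  by move=> t; rewrite hornerMXaddC.
apply: exp_smallD; last exact: exp_small_cst.
by rewrite -[0]addr0; apply: exp_smallM.
Unshelve. all: by end_near. Qed.

Arguments exp_small_expR : clear implicits.

Lemma exp_small_exppoly (p : {poly R}) (mu : R) :
  exp_small mu (fun t => p.[t] * expR (- mu * t)).
Proof.
rewrite -[X in exp_small X]add0r.
by apply: exp_smallM; [exact: exp_small_horner|exact: exp_small_expR].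
Qed.

Arguments exp_small_exppoly : clear implicits.

Lemma exp_small_cvg0 theta h : 0 < theta -> exp_small theta h -> h t @[t --> +oo] --> 0.
Proof.
move=> th0 hs; have th2 : theta / 2 < theta by lra.
have := hs _ th2 => hth; apply/cvgr0Pnorm_le => e e0; near=> t.
apply: (@le_trans _ _ (expR (- (theta / 2) * t))); first by near: t.
rewrite mulNr expRN invf_ple ?posrE ?expR_gt0 //.
apply: le_trans (expR_ge1Dx _); apply: ler_wpDl => //.
rewrite mulrC -ler_pdivrMr ?divr_gt0 //.
Unshelve. all: by end_near. Qed.

(** Turns asymptotic statements about constants into identities. *)
Lemma exp_small_cst_eq0 theta (c : R) : 0 < theta -> exp_small theta (cst c) -> c = 0.
Proof.
move=> th0 /(exp_small_cvg0 th0) c0; apply/esym.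
apply: (cvg_unique (@norm_hausdorff _ _) c0); exact: cvg_cst.
Qed.

Lemma exp_small_o_exp theta theta' h : theta' < theta -> exp_small theta h ->
  o_exp theta' h.
Proof.
move=> lt_th hs; have th0 : 0 < theta - theta' by rewrite subr_gt0.
apply: exp_small_cvg0 th0 _; apply: exp_smallM => //.
by have := exp_small_expR (- theta'); apply: exp_small_ext => t; rewrite opprK.
Qed.

Lemma o_exp_ext theta f g : f =1 g -> o_exp theta g -> o_exp theta f.
Proof. by move=> /funext ->. Qed.

Lemma o_expD theta f g : o_exp theta f -> o_exp theta g ->
  o_exp theta (fun t => f t + g t).
Proof.
rewrite /o_exp => fo go; rewrite -[X in _ --> X]addr0.
by under eq_fun do rewrite mulrDl; exact: cvgD.
Qed.

Lemma o_exp_sum theta (I : Type) (s : seq I) (P : pred I) (F : I -> R -> R) :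
  (forall i, P i -> o_exp theta (F i)) ->
  o_exp theta (fun t => \sum_(i <- s | P i) F i t).
Proof.
move=> Fo; elim: s => [|i s IHs].
  apply: (@o_exp_ext _ _ (cst 0)) => [t|]; first by rewrite big_nil.
  rewrite /o_exp /cst; under eq_fun do rewrite mul0r.
  exact: cvg_cst.
have [Pi|nPi] := boolP (P i).
  by apply: o_exp_ext (o_expD (Fo i Pi) IHs) => t; rewrite big_cons Pi.
by apply: o_exp_ext IHs => t; rewrite big_cons (negPf nPi).
Qed.

End ExpSmall.

Arguments exp_small_expR {R} mu.
Arguments exp_small_exppoly {R} p mu.

(** * Derivatives and integrals of small functions *)

Section ScalarDerivative.
Context {R : realType}.
Implicit Types (f g : R -> R) (t : R).

Lemma is_der_add f g t df dg : is_derive t 1 f df -> is_derive t 1 g dg ->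
  is_derive t 1 (fun u => f u + g u) (df + dg).
Proof. by move=> fD gD; exact: is_deriveD. Qed.

Lemma is_der_opp f t df : is_derive t 1 f df -> is_derive t 1 (fun u => - f u) (- df).
Proof. by move=> fD; exact: is_deriveN. Qed.

Lemma is_der_sub f g t df dg : is_derive t 1 f df -> is_derive t 1 g dg ->
  is_derive t 1 (fun u => f u - g u) (df - dg).
Proof. by move=> fD gD; exact: is_deriveB. Qed.

Lemma is_der_mul f g t df dg : is_derive t 1 f df -> is_derive t 1 g dg ->
  is_derive t 1 (fun u => f u * g u) (df * g t + f t * dg).
Proof.
move=> fD gD; apply: is_derive_eq.
by rewrite addrC [df * _]mulrC.
Qed.

Lemma is_der_scale (c : R) f t df : is_derive t 1 f df ->
  is_derive t 1 (fun u => c * f u) (c * df).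
Proof.
move=> fD; have := is_der_mul (is_derive_cst c t 1) fD.
by rewrite mul0r add0r.
Qed.

Lemma is_der_sum (I : Type) (s : seq I) (P : pred I) (F dF : I -> R -> R) t :
  (forall i, P i -> is_derive t 1 (F i) (dF i t)) ->
  is_derive t 1 (fun u => \sum_(i <- s | P i) F i u) (\sum_(i <- s | P i) dF i t).
Proof.
move=> FD; elim: s => [|i s IHs].
  rewrite big_nil (_ : (fun _ => _) = cst 0); first exact: is_derive_cst.
  by apply/funext => u; rewrite big_nil.
rewrite big_cons; have [Pi|nPi] := boolP (P i); last first.
  rewrite (_ : (fun _ => _) = fun u => \sum_(j <- s | P j) F j u) //.
  by apply/funext => u; rewrite big_cons (negPf nPi).
rewrite (_ : (fun _ => _) = fun u => F i u + \sum_(j <- s | P j) F j u).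
  by apply: is_der_add => //; exact: FD.
by apply/funext => u; rewrite big_cons Pi.
Qed.

Lemma is_der_expR (a t : R) : is_derive t 1 (fun u => expR (a * u)) (a * expR (a * t)).
Proof.
have aD : is_derive t 1 (fun u => a * u) (a * 1) by apply: is_der_scale; exact: is_derive_id.
have eD := is_derive_expR (a * t).
have := @is_derive1_comp _ expR (fun u => a * u) t _ _ eD aD.
by rewrite mulr1 /GRing.scale /= mulrC.
Qed.

Lemma is_der_eq f t df df' : is_derive t 1 f df -> df = df' -> is_derive t 1 f df'.
Proof. by move=> ? <-. Qed.

Lemma is_der_nincr f df (T : R) : (forall t, T < t -> is_derive t 1 f (df t)) ->
  (forall t, T < t -> df t <= 0) -> forall s t, T < s -> s <= t -> f t <= f s.
Proof.
move=> fD df0 s t Ts st.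
have fc : {within `[s, t], continuous f}.
  apply: derivable_within_continuous => u; rewrite in_itv /= => /andP[su _].
  by have ? := fD u (lt_le_trans Ts su); exact: ex_derive.
have fD' x : x \in `]s, t[ -> is_derive x 1 f (df x).
  by rewrite in_itv /= => /andP[sx _]; apply: fD; exact: lt_trans sx.
have [c + E] := MVT_segment st fD' fc; rewrite in_itv /= => /andP[sc _].
rewrite -subr_le0 E mulr_le0_ge0 ?subr_ge0 //; apply: df0.
exact: lt_le_trans sc.
Qed.

Lemma is_der_ndecr f df (T : R) : (forall t, T < t -> is_derive t 1 f (df t)) ->
  (forall t, T < t -> 0 <= df t) -> forall s t, T < s -> s <= t -> f s <= f t.
Proof.
move=> fD df0 s t Ts st; rewrite -lerN2.
apply: (@is_der_nincr (fun t => - f t) (fun t => - df t) T) => // u Tu.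
  by apply: is_der_opp; exact: fD.
by rewrite oppr_le0 df0.
Qed.

End ScalarDerivative.

Section Integrate.
Context {R : realType}.
Implicit Types (z g : R -> R) (theta r : R).

Lemma is_der_expR_div (c t : R) : c != 0 ->
  is_derive t 1 (fun u => c^-1 * expR (c * u)) (expR (c * t)).
Proof.
by move=> c0; have := is_der_scale c^-1 (is_der_expR c t); rewrite mulKf.
Qed.

(** If z' is bounded by exp(c t), then z - exp(c t) / c decreases and
    z + exp(c t) / c increases. *)
Lemma integrate_exp_bound z g (c T : R) : c != 0 ->
  (forall t, T < t -> is_derive t 1 z (g t)) ->
  (forall t, T < t -> `|g t| <= expR (c * t)) ->
  forall s t, T < s -> s <= t ->
    z t - c^-1 * expR (c * t) <= z s - c^-1 * expR (c * s) /\
    z s + c^-1 * expR (c * s) <= z t + c^-1 * expR (c * t).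
Proof.
move=> c0 zD gc s t Ts st; split.
  apply: (@is_der_nincr _ (fun u => z u - c^-1 * expR (c * u))
            (fun u => g u - expR (c * u)) T) => // u Tu.
    by apply: is_der_sub; [exact: zD|exact: is_der_expR_div].
  by rewrite subr_le0; apply: le_trans (ler_norm _) (gc _ Tu).
apply: (@is_der_ndecr _ (fun u => z u + c^-1 * expR (c * u))
          (fun u => g u + expR (c * u)) T) => // u Tu.
  by apply: is_der_add; [exact: zD|exact: is_der_expR_div].
by rewrite -lerBlDr sub0r lerNl; apply: le_trans (gc _ Tu); rewrite -normrN ler_norm.
Qed.

Lemma integrate_exp_small_nonpos z g theta : theta <= 0 ->
  (forall t : R, 0 < t -> is_derive t 1 z (g t)) -> exp_small theta g ->
  exp_small theta z.
Proof.
move=> th0 zD gs r rth; pose r' := (r + theta) / 2.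
have r'th : r' < theta by rewrite /r'; lra.
have /near_pinftyP [T [T0 gT]] := gs _ r'th.
pose c := - r'; have c0 : 0 < c by rewrite /c; lra.
have zD' t : T < t -> is_derive t 1 z (g t) by move=> Tt; apply: zD; exact: lt_trans Tt.
have gT' t : T < t -> `|g t| <= expR (c * t) by move=> /ltW; exact: gT.
have c0' : c != 0 by rewrite gt_eqF.
have T1 : T < T + 1 by rewrite ltrDl.
have H := integrate_exp_bound c0' zD' gT' T1.
pose K := `|z (T + 1)| + c^-1 * expR (c * (T + 1)).
suff : exp_small r' z by apply; rewrite /r'; lra.
apply: (@exp_small_dom _ _ _ (fun t => K + c^-1 * expR (c * t))).
  apply/near_pinftyP; exists (T + 1); split; first by rewrite addr_gt0.
  move=> t /H [H1 H2]; apply: le_trans (ler_norm _).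
  have e1 : 0 <= c^-1 * expR (c * (T + 1)) by rewrite mulr_ge0 ?invr_ge0 ?expR_ge0 // ltW.
  have := ler_norm (z (T + 1)); have := ler_norm (- z (T + 1)); rewrite normrN.
  by rewrite /K ler_norml; lra.
apply: exp_smallD.
  by apply: (exp_small_le (theta := 0)); [rewrite /r'; lra|exact: exp_small_cst].
by apply: exp_smallZ; exact: exp_small_expR.
Qed.

(** For one rate r, the functions z - b and z + b with b = exp(- r t) / r
    increase and decrease respectively and enclose z, so the supremum of z - b
    is a limit at that rate. Limits for different rates coincide, because their
    difference is a small constant. *)
Lemma integrate_exp_small_pos z g theta : 0 < theta ->
  (forall t : R, 0 < t -> is_derive t 1 z (g t)) -> exp_small theta g ->
  exists l, exp_small theta (fun t => z t - l).
Proof.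
move=> th0 zD gs.
have E r : 0 < r -> r < theta -> exists l, exp_small r (fun t => z t - l).
  move=> r0 rth; have /near_pinftyP [T [T0 gT]] := gs _ rth.
  have zD' t : T < t -> is_derive t 1 z (g t) by move=> Tt; apply: zD; exact: lt_trans Tt.
  have gT' t : T < t -> `|g t| <= expR (- r * t) by move=> /ltW; exact: gT.
  have r0' : - r != 0 by rewrite oppr_eq0 gt_eqF.
  pose b (t : R) := r^-1 * expR (- r * t).
  have b0 t : 0 <= b t by rewrite mulr_ge0 ?invr_ge0 ?expR_ge0 // ltW.
  have H s t : T < s -> s <= t -> z t + b t <= z s + b s /\ z s - b s <= z t - b t.
    move=> Ts st; have := integrate_exp_bound r0' zD' gT' Ts st.
    by rewrite /b invrN !mulNr !opprK.
  pose S := [set z t - b t | t in [set t | T < t]].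
  have ubS t : T < t -> ubound S (z t + b t).
    move=> Tt _ [s Ts <-]; case: (leP s t) => [st|/ltW ts].
      by have [_ H2] := H s t Ts st; apply: (le_trans H2); have := b0 t; lra.
    by have [H1 _] := H t s Tt ts; apply: le_trans H1; have := b0 s; lra.
  have T1 : T < T + 1 by rewrite ltrDl.
  have supS : has_sup S.
    by split; [exists (z (T + 1) - b (T + 1)), (T + 1)|exists (z (T + 1) + b (T + 1)); exact: ubS].
  exists (sup S); apply: (@exp_small_dom _ _ _ b); last first.
    by apply: exp_smallZ; exact: exp_small_expR.
  apply/near_pinftyP; exists (T + 1); split; first by rewrite addr_gt0.
  move=> t T1t; have Tt := lt_le_trans T1 T1t.
  have h1 : sup S <= z t + b t by apply: ge_sup (ubS t Tt); case: supS.
  have h2 : z t - b t <= sup S by apply: ub_le_sup; [case: supS|exists t].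
  by rewrite [leRHS]ger0_norm // ler_norml; lra.
(* the limit is fixed with the rate theta / 2, then compared with all others *)
have th20 : 0 < theta / 2 by lra.
have th2 : theta / 2 < theta by lra.
have [l ls] := E _ th20 th2; exists l => r rth.
pose r' := (Num.max r 0 + theta) / 2.
have rmax : r <= Num.max r 0 by rewrite le_max lexx.
have max0 : 0 <= Num.max r 0 by rewrite le_max lexx orbT.
have maxth : Num.max r 0 < theta by rewrite gt_max rth.
have r'0 : 0 < r' by rewrite /r'; lra.
have r'th : r' < theta by rewrite /r'; lra.
have [l' ls'] := E _ r'0 r'th.
suff -> : l = l' by apply: ls'; rewrite /r'; lra.
pose r2 := Num.min r' (theta / 2).
have r20 : 0 < r2 by rewrite lt_min r'0.
have h1 : exp_small r2 (fun t => z t - l).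
  by apply: exp_small_le ls; rewrite ge_min lexx orbT.
have h2 : exp_small r2 (fun t => z t - l').
  by apply: exp_small_le ls'; rewrite ge_min lexx.
have := exp_smallB h2 h1 => h3.
suff : l - l' = 0 by move/subr0_eq.
apply: (exp_small_cst_eq0 r20); apply: exp_small_ext h3 => t /=.
by rewrite /cst; ring.
Qed.

End Integrate.

(** * Linear equations on polynomial vectors *)

Section PolynomialOde.
Context {R : realType}.

Lemma deriv_surj (q : {poly R}) : exists p : {poly R}, p^`() = q.
Proof.
exists (\poly_(i < (size q).+1) (q`_i.-1 / i%:R)).
apply/polyP => i; rewrite coef_deriv coef_poly ltnS /=.
case: ltnP => [_|/leq_sizeP ->//]; last by rewrite mul0rn.
by rewrite -[LHS]mulr_natr divfK // pnatr_eq0.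
Qed.

(** For b nonzero, - q / b is a solution up to an error of smaller degree. *)
Lemma deriv_sub_scale_surj (b : R) (q : {poly R}) :
  exists p : {poly R}, p^`() - b *: p = q.
Proof.
have [->|b0] := eqVneq b 0.
  by have [p <-] := deriv_surj q; exists p; rewrite scale0r subr0.
have [k] := ubnP (size q); elim: k q => // k IHk q szq.
have [->|q0] := eqVneq q 0; first by exists 0; rewrite deriv0 scaler0 subr0.
have [|f fE] := IHk (b^-1 *: q^`()).
  rewrite (leq_ltn_trans (size_scale_leq _ _)) //.
  by rewrite (leq_trans (lt_size_deriv q0)) // -ltnS.
exists (f - b^-1 *: q); rewrite derivB derivZ scalerBr scalerA divff // scale1r.
rewrite -[RHS]addr0 -fE; ring.
Qed.

Lemma deriv_eq0 (p : {poly R}) : p^`() = 0 -> p = (p`_0)%:P.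
Proof.
move=> dp0; apply/polyP => -[|i]; rewrite coefC //=.
have : (p^`())`_i = 0 by rewrite dp0 coef0.
by rewrite coef_deriv -[LHS]mulr_natr => /eqP; rewrite mulf_eq0 pnatr_eq0 orbF => /eqP.
Qed.

Definition pval (n : nat) (p : 'rV[{poly R}]_n) (t : R) : 'rV[R]_n :=
  map_mx (horner_eval t) p.

Definition pderiv (n : nat) (p : 'rV[{poly R}]_n) : 'rV[{poly R}]_n :=
  map_mx (@deriv R) p.

Lemma pvalE n (p : 'rV[{poly R}]_n) t s : pval p t 0 s = (p 0 s).[t].
Proof. by rewrite mxE. Qed.

Lemma pval_mulC n k (p : 'rV[{poly R}]_n) (M : 'M[R]_(n, k)) t :
  pval (p *m M^P) t = pval p t *m M.
Proof.
rewrite /pval map_mxM -map_mx_comp; congr (_ *m _).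
by apply/matrixP => i j; rewrite !mxE /= /horner_eval hornerC.
Qed.

Lemma pderiv_mulC n k (p : 'rV[{poly R}]_n) (M : 'M[R]_(n, k)) :
  pderiv (p *m M^P) = pderiv p *m M^P.
Proof.
apply/rowP => s; rewrite !mxE raddf_sum; apply: eq_bigr => j _.
by rewrite !mxE /= derivM derivC mulr0 addr0.
Qed.

(** Solve up to a remainder g prod (B - b) over a list of numbers b that starts
    empty and grows: solving the scalar equations f' - b f = g and correcting c
    by f prod (B - b) puts one more factor B - b into the remainder. Over the
    full list the product vanishes, and so does the remainder. *)
Lemma pderiv_sub_surj n (B : 'M[R]_n) (bs : seq R) :
  \prod_(b <- bs) (B - b%:M) = 0 ->
  forall F : 'rV[{poly R}]_n, exists c, pderiv c = c *m B^P + F.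
Proof.
move=> prod0 F.
suff [c [g E]] : exists c g : 'rV[{poly R}]_n,
    pderiv c = c *m B^P + F + g *m (\prod_(b <- bs) (B - b%:M))^P.
  by exists c; rewrite E prod0 map_mx0 mulmx0 addr0.
elim: bs {prod0} => [|b bs [c [g E]]].
  exists 0, (- F); rewrite big_nil map_mx1 mulmx1 mul0mx add0r subrr.
  by apply/rowP => s; rewrite !mxE deriv0.
have /choice[f fE] : forall s, exists p : {poly R}, p^`() - b *: p = g 0 s.
  by move=> s; exact: deriv_sub_scale_surj.
pose fv : 'rV_n := \row_s f s.
have fvE : pderiv fv = g + fv *m (b%:M)^P.
  rewrite map_scalar_mx mul_mx_scalar; apply/rowP => s.
  by rewrite !mxE -fE -mul_polyC subrK.
set P := \prod_(b <- bs) _ in E *.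
have PB : P *m B = B *m P.
  apply/esym/commr_prod => i _; apply: commrB; first exact: commr_refl.
  exact: scalar_mxC.
exists (c - fv *m P^P), fv; rewrite big_cons -/P.
have -> : ((B - b%:M) * P)^P = B^P *m P^P - (b%:M)^P *m P^P.
  by rewrite -mulmxBl -map_mxB -map_mxM.
rewrite {1}/pderiv raddfB /= -/(pderiv _) -/(pderiv _) pderiv_mulC E fvE.
rewrite mulmxBl -[fv *m P^P *m _]mulmxA -map_mxM PB map_mxM mulmxDl mulmxBr.
rewrite -mulmxA opprD.
set u := c *m _; set v := g *m _; set x := fv *m (B^P *m _); set y := fv *m _.
by apply/rowP => s; rewrite !mxE; ring.
Qed.

End PolynomialOde.

(** * Asymptotics of linear systems with a nilpotent part *)

Section VectorFunctions.
Context {R : realType}.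
Implicit Types (n : nat) (theta : R).

Definition vsmall n theta (y : R -> 'rV[R]_n) : Prop :=
  forall s, exp_small theta (fun t => y t 0 s).

(** Only positive times count, as in the differential equation; nothing is known
    about the solutions at negative times. *)
Definition vderiv n (y dy : R -> 'rV[R]_n) : Prop :=
  forall t : R, 0 < t -> forall s, is_derive t 1 (fun u => y u 0 s) (dy t 0 s).

Lemma vsmall_le n theta theta' (y : R -> 'rV[R]_n) : theta' <= theta ->
  vsmall theta y -> vsmall theta' y.
Proof. by move=> le_th ys s; apply: exp_small_le (ys s). Qed.

Lemma vsmall_eq n theta (y z : R -> 'rV[R]_n) : (forall t : R, 0 < t -> y t = z t) ->
  vsmall theta z -> vsmall theta y.
Proof. by move=> yz zs s; apply: exp_small_eq (zs s) => t /yz ->. Qed.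

Lemma vsmall0 n theta : vsmall theta (fun=> 0 : 'rV[R]_n).
Proof. by move=> s; have := @exp_small0 R theta; apply: exp_small_ext => t; rewrite mxE. Qed.

Lemma vsmallD n theta (y z : R -> 'rV[R]_n) : vsmall theta y -> vsmall theta z ->
  vsmall theta (fun t => y t + z t).
Proof.
by move=> ys zs s; have := exp_smallD (ys s) (zs s); apply: exp_small_ext => t; rewrite mxE.
Qed.

Lemma vsmallN n theta (y : R -> 'rV[R]_n) : vsmall theta y ->
  vsmall theta (fun t => - y t).
Proof. by move=> ys s; have := exp_smallN (ys s); apply: exp_small_ext => t; rewrite mxE. Qed.

Lemma vsmallB n theta (y z : R -> 'rV[R]_n) : vsmall theta y -> vsmall theta z ->
  vsmall theta (fun t => y t - z t).
Proof. by move=> ys zs; apply: vsmallD => //; exact: vsmallN. Qed.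

Lemma vsmall_sum n theta (I : Type) (r : seq I) (P : pred I) (F : I -> R -> 'rV[R]_n) :
  (forall i, P i -> vsmall theta (F i)) ->
  vsmall theta (fun t => \sum_(i <- r | P i) F i t).
Proof.
move=> Fs s; have := exp_small_sum r (fun i Pi => Fs i Pi s).
by apply: exp_small_ext => t; rewrite summxE.
Qed.

Lemma vsmallZ n theta theta' (f : R -> R) (y : R -> 'rV[R]_n) : exp_small theta f ->
  vsmall theta' y -> vsmall (theta + theta') (fun t => f t *: y t).
Proof.
by move=> fs ys s; have := exp_smallM fs (ys s); apply: exp_small_ext => t; rewrite mxE.
Qed.

Lemma vsmall_mul n k theta (y : R -> 'rV[R]_n) (M : 'M[R]_(n, k)) : vsmall theta y ->
  vsmall theta (fun t => y t *m M).
Proof.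
move=> ys s; have H j : true -> exp_small theta (fun t => M j s * y t 0 j).
  by move=> _; exact: exp_smallZ.
have := exp_small_sum (index_enum _) H.
by apply: exp_small_ext => t; rewrite mxE; apply: eq_bigr => j _; rewrite mulrC.
Qed.

Lemma vsmall_exppoly n (p : 'rV[{poly R}]_n) (mu : R) :
  vsmall mu (fun t => expR (- mu * t) *: pval p t).
Proof.
move=> s; have := exp_small_exppoly (p 0 s) mu.
by apply: exp_small_ext => t; rewrite mxE pvalE mulrC.
Qed.

Lemma vderiv_mul n k (y dy : R -> 'rV[R]_n) (M : 'M[R]_(n, k)) : vderiv y dy ->
  vderiv (fun t => y t *m M) (fun t => dy t *m M).
Proof.
move=> yD t t0 s; rewrite mxE (_ : (fun _ => _) = fun u => \sum_j M j s * y u 0 j).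
  rewrite (eq_bigr (fun j => M j s * dy t 0 j)); last by move=> j _; rewrite mulrC.
  apply: (@is_der_sum _ _ _ _ (fun j u => M j s * y u 0 j) (fun j u => M j s * dy u 0 j)) => j _.
  by apply: is_der_scale; exact: yD.
by apply/funext => u; rewrite mxE; apply: eq_bigr => j _; rewrite mulrC.
Qed.

Lemma vderiv_expR n (y dy : R -> 'rV[R]_n) (c : R) : vderiv y dy ->
  vderiv (fun t => expR (c * t) *: y t) (fun t => expR (c * t) *: (c *: y t + dy t)).
Proof.
move=> yD t t0 s; rewrite !mxE (_ : (fun _ => _) = fun u => expR (c * u) * y u 0 s).
  apply: is_der_eq; first exact: (is_der_mul (is_der_expR c t) (yD t t0 s)).
  by move=> /=; ring.
by apply/funext => u; rewrite mxE.
Qed.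

Lemma vderivB n (y dy z dz : R -> 'rV[R]_n) : vderiv y dy -> vderiv z dz ->
  vderiv (fun t => y t - z t) (fun t => dy t - dz t).
Proof.
move=> yD zD t t0 s; rewrite !mxE (_ : (fun _ => _) = fun u => y u 0 s - z u 0 s).
  by apply: is_der_sub; [exact: yD|exact: zD].
by apply/funext => u; rewrite !mxE.
Qed.

Lemma vderiv_sum n (I : Type) (r : seq I) (P : pred I) (F dF : I -> R -> 'rV[R]_n) :
  (forall i, P i -> vderiv (F i) (dF i)) ->
  vderiv (fun t => \sum_(i <- r | P i) F i t) (fun t => \sum_(i <- r | P i) dF i t).
Proof.
move=> FD t t0 s; rewrite summxE.
rewrite (_ : (fun _ => _) = fun u => \sum_(i <- r | P i) F i u 0 s).
  by apply: (@is_der_sum _ _ _ _ (fun i u => F i u 0 s) (fun i u => dF i u 0 s)) => i /FD; apply.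
by apply/funext => u; rewrite summxE.
Qed.

Lemma vderiv_eq n (y dy dz : R -> 'rV[R]_n) : vderiv y dy ->
  (forall t : R, 0 < t -> dy t = dz t) -> vderiv y dz.
Proof. by move=> yD E t t0 s; rewrite -E //; exact: yD. Qed.

Lemma vderiv_pval n (p : 'rV[{poly R}]_n) : vderiv (pval p) (pval (pderiv p)).
Proof.
move=> t t0 s; rewrite pvalE mxE (_ : (fun _ => _) = horner (p 0 s)).
  exact: is_derive_poly.
by apply/funext => u; rewrite pvalE.
Qed.

Lemma vsmall_integrate_nonpos n theta (y g : R -> 'rV[R]_n) : theta <= 0 ->
  vderiv y g -> vsmall theta g -> vsmall theta y.
Proof.
move=> th0 yD gs s.
by apply: integrate_exp_small_nonpos (gs s) => // t t0; exact: yD.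
Qed.

Lemma vsmall_integrate_pos n theta (y g : R -> 'rV[R]_n) : 0 < theta ->
  vderiv y g -> vsmall theta g ->
  exists l, vsmall theta (fun t => y t - l).
Proof.
move=> th0 yD gs.
have /choice[l ls] : forall s, exists l, exp_small theta (fun t => y t 0 s - l).
  by move=> s; apply: integrate_exp_small_pos (gs s) => // t t0; exact: yD.
by exists (\row_s l s) => s; apply: exp_small_ext (ls s) => t; rewrite !mxE.
Qed.

Lemma pval_small_cst_eq0 n theta (p : 'rV[{poly R}]_n) : 0 < theta ->
  pderiv p = 0 -> vsmall theta (pval p) -> p = 0.
Proof.
move=> th0 /rowP dp0 ps; apply/rowP => s.
have /deriv_eq0 pE : (p 0 s)^`() = 0 by have := dp0 s; rewrite !mxE.
rewrite mxE pE; have c0 : (p 0 s)`_0 = 0; last by rewrite c0.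
apply: (exp_small_cst_eq0 th0); apply: exp_small_ext (ps s) => t.
by rewrite pvalE pE hornerC coefC.
Qed.

End VectorFunctions.

Section NilpotentLinear.
Context {R : realType}.

(** By induction on k: y M satisfies the same equation with a smaller exponent,
    so y M = q + small, and p is an antiderivative of q shifted by the limit of
    y minus that antiderivative. Then p M - q has zero derivative and is small,
    hence p M = q = p'. The last two clauses say that the polynomial
    part vanishes when y decays already, and may be taken to be zero when the
    forcing term is not known to decay. *)
Lemma nilpotent_linear_asymptotics n (M : 'M[R]_n) (k : nat) (theta : R)
    (y g : R -> 'rV[R]_n) :
  (forall t : R, 0 < t -> y t *m M ^+ k = 0) ->
  vderiv y (fun t => y t *m M + g t) -> vsmall theta g ->
  exists p : 'rV[{poly R}]_n, [/\ pderiv p = p *m M^P,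
    vsmall theta (fun t => y t - pval p t),
    forall eta, 0 < eta -> vsmall eta y -> p = 0 &
    theta <= 0 -> p = 0].
Proof.
have pval0 t : pval 0 t = 0 :> 'rV[R]_n.
  by apply/rowP => s; rewrite pvalE !mxE horner0.
have pderiv0 : pderiv 0 = 0 :> 'rV[{poly R}]_n.
  by apply/rowP => s; rewrite !mxE deriv0.
elim: k y g => [|k IHk] y g yM yD gs.
  exists 0; split=> //; first by rewrite pderiv0 mul0mx.
  apply: vsmall_eq (@vsmall0 _ _ _) => t t0.
  by rewrite pval0 subr0 -[LHS]mulmx1 -[1%:M]/(M ^+ 0) yM.
have wM t : 0 < t -> y t *m M *m M ^+ k = 0.
  by move=> t0; rewrite -mulmxA -[M *m _]/(M * M ^+ k) -exprS yM.
have wD : vderiv (fun t => y t *m M) (fun t => y t *m M *m M + g t *m M).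
  by apply: vderiv_eq (vderiv_mul M yD) _ => t _; rewrite mulmxDl.
have [q [qD ys qeta qth]] := IHk _ _ wM wD (vsmall_mul M gs).
have [th0|th0] := leP theta 0.
  exists 0; split=> //; first by rewrite pderiv0 mul0mx.
  have ws : vsmall theta (fun t => y t *m M).
    by apply: vsmall_eq ys => t _; rewrite qth // pval0 subr0.
  apply: (@vsmall_eq _ _ _ _ y); first by move=> t _; rewrite pval0 subr0.
  exact: vsmall_integrate_nonpos yD (vsmallD ws gs).
have /choice[Q QE] : forall s, exists Q : {poly R}, Q^`() = q 0 s.
  by move=> s; exact: deriv_surj.
pose Qv : 'rV_n := \row_s Q s.
have QvD : pderiv Qv = q by apply/rowP => s; rewrite !mxE.
have yQD : vderiv (fun t => y t - pval Qv t) (fun t => (y t *m M - pval q t) + g t).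
  apply: vderiv_eq (vderivB yD (vderiv_pval Qv)) _ => t _.
  by rewrite QvD addrAC.
have [l ls] := vsmall_integrate_pos th0 yQD (vsmallD ys gs).
pose p := Qv + l^P.
have pE t : pval p t = pval Qv t + l.
  by apply/rowP => s; rewrite !(pvalE, mxE) hornerD hornerC.
have pD : pderiv p = q.
  by rewrite -QvD; apply/rowP => s; rewrite !mxE derivD derivC addr0.
have yp : vsmall theta (fun t => y t - pval p t).
  by apply: vsmall_eq ls => t _; rewrite pE opprD addrA.
exists p; split=> //.
  rewrite pD; apply/eqP; rewrite -subr_eq0; apply/eqP.
  apply: (pval_small_cst_eq0 th0).
    apply/rowP => s; rewrite {1}/pderiv raddfB /= -/(pderiv _) -/(pderiv _).
    by rewrite pderiv_mulC pD qD subrr.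
  apply: vsmall_eq (vsmallB (vsmall_mul M yp) ys) => t _.
  rewrite mulmxBl -pval_mulC.
  rewrite [in LHS]/pval raddfB /= -/(pval _ _) -/(pval _ _).
  by rewrite opprB [RHS]addrC addrA subrK.
move=> eta eta0 yeta; have q0 : q = 0 by apply: (qeta _ eta0); exact: vsmall_mul.
have m0 : 0 < Num.min eta theta by rewrite lt_min eta0.
apply: (pval_small_cst_eq0 m0); first by rewrite pD.
have h1 : vsmall (Num.min eta theta) y by apply: vsmall_le yeta; rewrite ge_min lexx.
have h2 := vsmall_le _ yp.
apply: vsmall_eq (vsmallB h1 (h2 (Num.min eta theta) _)) => [t _|].
  by rewrite opprB addrC subrK.
by rewrite ge_min lexx orbT.
Qed.

End NilpotentLinear.

(** * Asymptotics of linear systems with real spectrum *)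

Section LinearAsymptotics.
Context {R : realType}.

(** A Bezout identity between ('X + lam_i)^k and the product of the other
    factors splits u into u Q, killed by (A + lam_i)^k, and a part killed by
    the other factors. After multiplication by exp(lam_i t), u Q solves a
    nilpotent system. *)
Lemma linear_asymptotics (n m : nat) (A : 'M[R]_n.+1) (lam : 'I_m -> R) (k : nat)
    (theta theta' : R) (s : seq 'I_m) (u h : R -> 'rV[R]_n.+1) :
  injective lam -> uniq s ->
  vderiv u (fun t => u t *m A + h t) -> vsmall theta u -> vsmall theta' h ->
  (forall t, 0 < t ->
    u t *m horner_mx A (\prod_(i <- s) ('X - (- lam i)%:P) ^+ k) = 0) ->
  exists e : 'I_m -> 'rV[{poly R}]_n.+1,
    [/\ forall i, pderiv (e i) = e i *m (A + (lam i)%:M)^P,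
        forall i, lam i < theta -> e i = 0 &
        vsmall theta' (fun t => u t - \sum_(i <- s) expR (- lam i * t) *: pval (e i) t)].
Proof.
move=> lam_inj; pose q i : {poly R} := ('X - (- lam i)%:P) ^+ k.
elim: s u h => [|i s IHs] u h /=.
  move=> _ uD us hs u0; exists (fun=> 0); split=> //.
    by move=> i; rewrite mul0mx; apply/rowP => s; rewrite !mxE deriv0.
  apply: vsmall_eq (@vsmall0 _ _ _) => t t0.
  by rewrite big_nil subr0; have := u0 t t0; rewrite big_nil rmorph1 mulmx1.
move=> /andP[is_ s_uniq] uD us hs u0.
set P := \prod_(j <- s) q j.
have : coprimep (q i) P.
  rewrite /P; elim: s is_ {s_uniq IHs u0 P} => [|j s IHs].
    by rewrite big_nil coprimep1.
  rewrite big_cons coprimepMr inE negb_or => /andP[ij /IHs ->]; rewrite andbT.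
  apply: coprimep_expl; apply: coprimep_expr; apply: coprimep_XsubC2.
  by rewrite opprK addrC subr_eq0; apply: contra_neq ij => /lam_inj.
move=> /Bezout_eq1_coprimepP [[v w] /= vw].
have comA (p : {poly R}) : A *m horner_mx A p = horner_mx A p *m A.
  exact/esym/comm_horner_mx.
have uPD (p : {poly R}) : vderiv (fun t => u t *m horner_mx A p)
    (fun t => u t *m horner_mx A p *m A + h t *m horner_mx A p).
  apply: vderiv_eq (vderiv_mul (horner_mx A p) uD) _ => t _.
  by rewrite mulmxDl -!mulmxA comA.
have mulP (p1 p2 : {poly R}) : horner_mx A p1 *m horner_mx A p2 = horner_mx A (p1 * p2).
  by rewrite rmorphM.
have [e' [e'D e'th e's]] : exists e' : 'I_m -> 'rV[{poly R}]_n.+1,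
    [/\ forall j, pderiv (e' j) = e' j *m (A + (lam j)%:M)^P,
        forall j, lam j < theta -> e' j = 0 &
        vsmall theta' (fun t => u t *m horner_mx A (v * q i) -
           \sum_(j <- s) expR (- lam j * t) *: pval (e' j) t)].
  apply: (IHs _ _ s_uniq (uPD _) (vsmall_mul _ us) (vsmall_mul _ hs)) => t t0.
  rewrite -mulmxA mulP -mulrA [v * _]mulrC -mulP mulmxA.
  by have := u0 t t0; rewrite big_cons => ->; rewrite mul0mx.
pose Q := horner_mx A (w * P).
pose y t := expR (lam i * t) *: (u t *m Q).
have yM t : 0 < t -> y t *m (A + (lam i)%:M) ^+ k = 0.
  move=> t0; have -> : (A + (lam i)%:M) ^+ k = horner_mx A (q i).
    by rewrite rmorphXn rmorphB /= horner_mx_X horner_mx_C raddfN opprK.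
  rewrite -scalemxAl -mulmxA mulP -mulrA [w * _]mulrC [P * _]mulrC -mulP mulmxA.
  by have := u0 t t0; rewrite big_cons => ->; rewrite mul0mx scaler0.
have yD : vderiv y (fun t => y t *m (A + (lam i)%:M) + expR (lam i * t) *: (h t *m Q)).
  apply: vderiv_eq (vderiv_expR (lam i) (uPD _)) _ => t _.
  rewrite /y mulmxDr mul_mx_scalar -scalemxAl !scalerDr addrA.
  rewrite -/Q; congr (_ + _); rewrite addrC; congr (_ + _).
  by rewrite !scalerA mulrC.
have expS : exp_small (- lam i) (fun t => expR (lam i * t)).
  by have := exp_small_expR (- lam i); rewrite opprK.
have [p [pD ps peta pth]] := nilpotent_linear_asymptotics yM yD
  (vsmallZ expS (vsmall_mul Q hs)).
exists (fun j => if j == i then p else e' j); split=> [j|j|].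
- by case: eqVneq => [->|_].
- case: eqVneq => [->|_] lt_th; last exact: e'th.
  apply: (peta (- lam i + theta)); first by rewrite addrC subr_gt0.
  exact: vsmallZ expS (vsmall_mul Q us).
have := vsmallZ (exp_small_expR (lam i)) ps; rewrite addrA subrr add0r => ps'.
have := vsmallD ps' e's.

apply: vsmall_eq => t _; rewrite big_cons eqxx.
rewrite (eq_big_seq (fun j => expR (- lam j * t) *: pval (e' j) t)); last first.
  by move=> j js; case: eqVneq => // ji; rewrite -ji js in is_.
have uE : u t = u t *m Q + u t *m horner_mx A (v * q i).
  by rewrite -mulmxDr -rmorphD /= addrC vw rmorph1 mulmx1.
rewrite {1}uE scalerBr /y scalerA -expRD mulNr addNr expR0 scale1r.
by rewrite opprD addrACA.
Qed.

End LinearAsymptotics.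

(** * Functions with continuous partial derivatives *)

Section PartialDerivatives.
Context {R : realType}.

Lemma is_derive_line n k (f : 'rV[R]_n -> 'rV[R]_k) (a v : 'rV[R]_n) (t : R) s :
  derivable f (t *: v + a) v ->
  is_derive t 1 (fun u => f (u *: v + a) 0 s) ('D_v f (t *: v + a) 0 s).
Proof.
move=> fD; pose g (u : R) := f (u *: v + a).
have E : (fun h : R => h^-1 *: ((g \o shift t) (h *: (1 : R)) - g t)) =
         (fun h => h^-1 *: ((f \o shift (t *: v + a)) (h *: v) - f (t *: v + a))).
  by apply/funext => h /=; rewrite /g scalerDl addrA [_%:A]mulr1.
have gD : derivable g t 1 by rewrite /derivable E.
have gE : 'D_1 g t = 'D_v f (t *: v + a) by rewrite /derive E.
apply: DeriveDef; first exact: ((derivable_mxP _ _ _).1 gD).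
by rewrite -gE derive_mx // mxE.
Qed.

Lemma derivative_bound_lipschitz (g dg : R -> R) (B a b : R) :
  (forall t : R, is_derive t 1 g (dg t)) ->
  (forall t, Num.min a b <= t <= Num.max a b -> `|dg t| <= B) ->
  `|g b - g a| <= B * `|b - a|.
Proof.
move=> gD gB.
wlog ab : a b gB / a <= b.
  move=> H; have [/H|/ltW ba] := leP a b; first exact.
  by rewrite distrC [`|b - a|]distrC; apply: H => // t; rewrite minC maxC; exact: gB.
have gc : {within `[a, b], continuous g}.
  by apply: derivable_within_continuous => u _; have ? := gD u; exact: ex_derive.
have [c cab E] := MVT_segment ab (fun x _ => gD x) gc.
rewrite E normrM ler_wpM2r //; apply: gB.
by move: cab; rewrite in_itv /= (min_idPl ab) (max_idPr ab).
Qed.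

Definition in_box n (p : 'rV[R]_n) (r : R) (y : 'rV[R]_n) : Prop :=
  forall j, `|y 0 j - p 0 j| <= r.

(** Moving from y' to y one coordinate at a time never leaves the box. *)
Lemma box_lipschitz n (g : 'rV[R]_n -> R) (dg : 'I_n -> 'rV[R]_n -> R)
    (p : 'rV[R]_n) (r B : R) :
  (forall j a (t : R), is_derive t 1 (fun u => g (u *: delta_mx 0 j + a))
                          (dg j (t *: delta_mx 0 j + a))) ->
  (forall j z, in_box p r z -> `|dg j z| <= B) ->
  forall y y', in_box p r y -> in_box p r y' ->
  `|g y - g y'| <= B * \sum_j `|y 0 j - y' 0 j|.
Proof.
move=> gD gB y y' yp y'p.
pose z (k : nat) : 'rV[R]_n := \row_j (if (j < k)%N then y 0 j else y' 0 j).
have zp k : in_box p r (z k) by move=> j; rewrite mxE; case: ifP.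
have step (k : 'I_n) : `|g (z k.+1) - g (z k)| <= B * `|y 0 k - y' 0 k|.
  pose a : 'rV[R]_n := z k - y' 0 k *: delta_mx 0 k.
  have zE (u : R) j : (u *: delta_mx 0 k + a) 0 j = if j == k then u else z k 0 j.
    rewrite !mxE eqxx /=; case: eqVneq => [->|_]; last by rewrite !mulr0 subr0 add0r.
    by rewrite ltnn !mulr1 subrr addr0.
  have zk : z k = y' 0 k *: delta_mx 0 k + a by rewrite addrC subrK.
  have zk1 : z k.+1 = y 0 k *: delta_mx 0 k + a.
    apply/rowP => j; rewrite zE !mxE ltnS leq_eqVlt.
    have -> : (j == k :> nat) = (j == k) by [].
    by case: eqVneq => [->|].
  rewrite zk1 zk; apply: (@derivative_bound_lipschitz (fun u => g (u *: delta_mx 0 k + a)) _ B _ _ (gD k a)) => u uyy.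
  apply: gB => j; rewrite zE; case: eqVneq => [->|_]; last exact: zp.
  have := yp k; have := y'p k; rewrite !ler_norml => /andP[h1 h2] /andP[h3 h4].
  have [h5 h6] := andP uyy.
  have h7 : p 0 k - r <= Num.min (y' 0 k) (y 0 k) by rewrite le_min; apply/andP; split; lra.
  have h8 : Num.max (y' 0 k) (y 0 k) <= p 0 k + r by rewrite ge_max; apply/andP; split; lra.
  by apply/andP; split; lra.
have zn : z n = y by apply/rowP => j; rewrite mxE ltn_ord.
have z0 : z 0%N = y' by apply/rowP => j; rewrite mxE.
have -> : g y - g y' = \sum_(k < n) (g (z k.+1) - g (z k)).
  rewrite -(big_mkord xpredT (fun k => g (z k.+1) - g (z k))).
  by rewrite (telescope_sumr (fun k => g (z k))) // zn z0.
rewrite mulr_sumr.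
by apply: (le_trans (ler_norm_sum _ _ _)); apply: ler_sum => k _; exact: step.
Qed.

Definition partial n k (f : 'rV[R]_n -> 'rV[R]_k) (j : 'I_n) : 'rV[R]_n -> 'rV[R]_k :=
  fun a => 'D_(delta_mx 0 j) f a.

Lemma Ck_le n k q q' (f : 'rV[R]_n -> 'rV[R]_k) : (q' <= q)%N -> Ck q f -> Ck q' f.
Proof.
elim: q q' f => [|q IHq] [|q'] f //=; first by move=> _ [].
by rewrite ltnS => qq' [fc fD]; split=> // j; have [? ?] := fD j; split=> //; exact: IHq.
Qed.

Lemma Ck_partial n k q (f : 'rV[R]_n -> 'rV[R]_k) j : Ck q.+1 f -> Ck q (partial f j).
Proof. by move=> [_ /(_ j) []]. Qed.

Lemma Ck_continuous n k q (f : 'rV[R]_n -> 'rV[R]_k) : Ck q f -> continuous f.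
Proof. by case: q => [|q] []. Qed.

Lemma rV_norm_ge n (v : 'rV[R]_n) j : `|v 0 j| <= `|v|.
Proof.
rewrite [leRHS]/Num.Def.normr /= mx_normrE.
exact: (le_bigmax 0 (fun i : 'I_1 * 'I_n => `|v i.1 i.2|) (0, j)).
Qed.

Lemma rV_norm_le n (v : 'rV[R]_n) r : 0 <= r -> (forall j, `|v 0 j| <= r) -> `|v| <= r.
Proof.
move=> r0 vr; rewrite [leLHS]/Num.Def.normr /= mx_normrE.
by apply: bigmax_le => // -[i j] _; rewrite /= ord1.
Qed.

Lemma in_box_nbhs n (p : 'rV[R]_n) (P : 'rV[R]_n -> Prop) :
  (\forall z \near p, P z) <-> exists2 r, 0 < r & forall z, in_box p r z -> P z.
Proof.
split=> [/nbhs_ballP [r /= r0 rP]|[r r0 rP]].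
  have r20 : 0 < r / 2 by rewrite divr_gt0.
  exists (r / 2) => // z zp; apply: rP.
  rewrite -ball_normE /ball_ /=; apply: (@le_lt_trans _ _ (r / 2)); last by lra.
  by apply: rV_norm_le => [|j]; [exact: ltW|rewrite !mxE distrC; exact: zp].
apply/nbhs_ballP; exists r => //= z pz; apply: rP => j; rewrite distrC ltW //.
move: pz; rewrite -ball_normE /ball_ /=; apply: le_lt_trans.
by have := rV_norm_ge (p - z) j; rewrite !mxE.
Qed.

Lemma continuous_near_coord n k (f : 'rV[R]_n -> 'rV[R]_k) (p : 'rV[R]_n) (e : R) :
  continuous f -> 0 < e ->
  \forall z \near p, forall s, `|f z 0 s - f p 0 s| <= e.
Proof.
move=> fc e0; have := fc p; move/cvgrPdist_le => /(_ e e0); apply: filterS => z h s.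
by apply: le_trans h; have := rV_norm_ge (f p - f z) s; rewrite !mxE distrC.
Qed.

Lemma is_derive_partial n k q (f : 'rV[R]_n -> 'rV[R]_k) s : Ck q.+1 f ->
  forall j a (t : R), is_derive t 1 (fun u => f (u *: delta_mx 0 j + a) 0 s)
    (partial f j (t *: delta_mx 0 j + a) 0 s).
Proof. by move=> [_ fD] j a t; apply: is_derive_line; have [] := fD j. Qed.

(** Subtracting the candidate differential leaves a map whose partial
    derivatives are small near the base point, so it is Lipschitz there with an
    arbitrarily small constant. *)
Lemma C1_differentiable n k (f : 'rV[R]_n -> 'rV[R]_k) (p : 'rV[R]_n) :
  Ck 1 f -> differentiable f p.
Proof.
move=> fC1; pose J : 'M[R]_(n, k) := \matrix_(j, s) partial f j p 0 s.
pose df : {linear 'rV[R]_n -> 'rV[R]_k} := mulmxr J.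
have dfc : continuous df.
  move=> x; apply: differentiable_continuous.
  rewrite (_ : (df : _ -> _) = \sum_(j < n) (fun y : 'rV[R]_n => y 0 j *: row j J)).
    by apply: differentiable_sum => j; apply: differentiableZl; exact: differentiable_coord.
  by apply/funext => y; rewrite fct_sumE /= mulmx_sum_row.
have main : f = (fun x => f p + df (x - p)) +o_ (nbhs p) (fun x => x - p).
  apply/eqaddoP => e e0.
  pose e' := e / n.+1%:R; have e'0 : 0 < e' by rewrite divr_gt0 // ltr0n.
  have /in_box_nbhs[r r0 rP] : \forall z \near p, forall j s,
      `|partial f j z 0 s - partial f j p 0 s| <= e'.
    have H j : \forall z \near p, forall s, `|partial f j z 0 s - partial f j p 0 s| <= e'.
      by apply: continuous_near_coord => //; exact: Ck_continuous (Ck_partial j fC1).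
    exact: (filter_forall _ H).
  apply/in_box_nbhs; exists r => // y yp.
  apply: rV_norm_le => [|s]; first by rewrite mulr_ge0 // ltW.
  pose g (x : 'rV[R]_n) := f x 0 s - \sum_j x 0 j * J j s.
  have gD j a (t : R) : is_derive t 1 (fun u => g (u *: delta_mx 0 j + a))
      (partial f j (t *: delta_mx 0 j + a) 0 s - J j s).
    apply: is_der_sub; first exact: (is_derive_partial s fC1 j a t).
    rewrite (_ : (fun _ => _) = fun u => u * J j s + \sum_i a 0 i * J i s).
      have := is_der_add (is_der_mul (is_derive_id t 1) (is_derive_cst (J j s) t 1))
        (is_derive_cst (\sum_i a 0 i * J i s) t 1).
      by rewrite mul1r mulr0 !addr0.
    apply/funext => u; rewrite (bigD1 j) //= [in RHS](bigD1 j) //= !mxE !eqxx.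
    rewrite mulr1 mulrDl -addrA; congr (_ + (_ + _)); apply: eq_bigr => i ij.
    by rewrite !mxE (negPf ij) andbF mulr0 add0r.
  have pp : in_box p r p by move=> j; rewrite subrr normr0 ltW.
  have gB j z : in_box p r z -> `|partial f j z 0 s - J j s| <= e'.
    by move=> zp; rewrite [J _ _]mxE; exact: rP.
  have := box_lipschitz gD gB yp pp.
  have -> : g y - g p = (f - (fun x => f p + df (x - p))) y 0 s.
    rewrite -[(f - _) y]/(f y - (f p + (y - p) *m J)) /g mulmxBl [RHS]mxE [X in _ = _ + X]mxE.
    rewrite [(f p + _) 0 s]mxE [(y *m J - _) 0 s]mxE [(- (p *m J)) 0 s]mxE.
    by rewrite [(y *m J) 0 s]mxE [(p *m J) 0 s]mxE; ring.
  move/le_trans; apply; rewrite /e' -mulrA ler_wpM2l ?(ltW e0) //.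
  rewrite mulrC ler_pdivrMr ?ltr0n //.
  apply: (@le_trans _ _ (\sum_(j < n) `|y - p|)).
    by apply: ler_sum => j _; have := rV_norm_ge (y - p) j; rewrite !mxE.
  rewrite sumr_const card_ord -[X in X <= _]mulr_natr; apply: ler_wpM2l => //.
  by rewrite ler_nat.
apply/diffP => /=.
apply: (@getPex _ (fun (df : {linear 'rV[R]_n -> 'rV[R]_k}) => continuous df /\
  forall y, f y = f (lim (nbhs p)) + df (y - lim (nbhs p))
                  +o_(y \near p) (y - lim (nbhs p)))).
exists df; split=> //; apply: eqaddoEx => y.
rewrite lim_id //; exact: (congr1 (@^~ y) main).
Qed.

Lemma is_derive_segment n k (f : 'rV[R]_n -> 'rV[R]_k) (a v : 'rV[R]_n) (t : R) s :
  Ck 1 f -> is_derive t 1 (fun u => f (u *: v + a) 0 s)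
    (\sum_j v 0 j * partial f j (t *: v + a) 0 s).
Proof.
move=> fC1; have fd := C1_differentiable (t *: v + a) fC1.
have := is_derive_line s (diff_derivable (v := v) fd).
rewrite (_ : 'D_v f _ 0 s = \sum_j v 0 j * partial f j (t *: v + a) 0 s) //.
rewrite deriveEjacobian // {1}[v]row_sum_delta mulmx_suml summxE.
by apply: eq_bigr => j _; rewrite -scalemxAl mxE /partial -deriveEjacobian.
Qed.



End PartialDerivatives.

(** * Taylor expansion at the origin *)

Section Taylor.
Context {R : realType}.

Lemma rV_subE n (u v : 'rV[R]_n) s : (u - v) 0 s = u 0 s - v 0 s.
Proof. by rewrite !mxE. Qed.

(** The k-th term is the k-th differential at 0 evaluated on the diagonal,
    divided by the factorial of k. *)
Fixpoint taylor_term n q (k : nat) (f : 'rV[R]_n -> 'rV[R]_q) (y : 'rV[R]_n) : 'rV[R]_q :=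
  if k is k'.+1 then k%:R^-1 *: \sum_j y 0 j *: taylor_term k' (partial f j) y
  else f 0.

Lemma taylor_termZ n q k (f : 'rV[R]_n -> 'rV[R]_q) (c : R) y :
  taylor_term k f (c *: y) = c ^+ k *: taylor_term k f y.
Proof.
elim: k f => [|k IHk] f /=; first by rewrite scale1r.
rewrite scalerA mulrC -scalerA; congr (_ *: _); rewrite scaler_sumr.
by apply: eq_bigr => j _; rewrite IHk !scalerA mxE exprS; congr (_ *: _); ring.
Qed.

Lemma is_der_pow (i : nat) (t : R) : is_derive t 1 (fun u : R => u ^+ i) (i%:R * t ^+ i.-1).
Proof.
have := is_derive_poly ('X^i : {poly R}) t.
rewrite (_ : horner 'X^i = fun u => u ^+ i); last by apply/funext => u; rewrite hornerXn.
by rewrite derivXn hornerMn hornerXn mulr_natl.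
Qed.

(** Along the segment t |-> t y, the remainder of order k.+1 has derivative
    sum_j y_j times the remainder of order k of the j-th partial derivative. *)
Lemma taylor_remainder n q k (f : 'rV[R]_n -> 'rV[R]_q) : Ck k f ->
  exists C r, [/\ 0 <= C, 0 < r &
    forall rho y, 0 <= rho -> rho <= r -> in_box 0 rho y ->
      forall s, `|(f y - \sum_(i < k) taylor_term i f y) 0 s| <= C * rho ^+ k].
Proof.
elim: k f => [|k IHk] f fk.
  have /in_box_nbhs[r r0 rP] := continuous_near_coord 0 (Ck_continuous fk) ltr01.
  exists (1 + `|f 0|), r; split; rewrite ?addr_ge0 // => rho y rho0 rhor yrho s.
  rewrite big_ord0 subr0 expr0 mulr1 -[f y 0 s](subrK (f 0 0 s)).
  apply: le_trans (ler_normD _ _) _; apply: lerD; last exact: rV_norm_ge.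
  by apply: rP => j; apply: le_trans (yrho j) rhor.
have /choice[C /choice[r CrP]] : forall j, exists C r, [/\ 0 <= C, 0 < r &
    forall rho y, 0 <= rho -> rho <= r -> in_box 0 rho y -> forall s,
    `|(partial f j y - \sum_(i < k) taylor_term i (partial f j) y) 0 s| <= C * rho ^+ k].
  by move=> j; apply: IHk; exact: Ck_partial.
exists (\sum_j C j), (\big[Num.min/1]_j r j); split.
- by apply: sumr_ge0 => j _; have [] := CrP j.
- by apply: lt_bigmin => // j _; have [] := CrP j.
move=> rho y rho0 rhor yrho s.
pose g (t : R) := f (t *: y + 0) 0 s - \sum_(i < k.+1) t ^+ i * taylor_term i f y 0 s.
pose dg (t : R) := \sum_j y 0 j *
  (partial f j (t *: y) - \sum_(i < k) taylor_term i (partial f j) (t *: y)) 0 s.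
have gD (t : R) : is_derive t 1 g (dg t).
  have fC1 : Ck 1 f by apply: Ck_le fk.
  have D1 := is_derive_segment 0 y t s fC1.
  have D2 := @is_der_sum R 'I_k.+1 (index_enum _) xpredT
    (fun i u => u ^+ i * taylor_term i f y 0 s)
    (fun i u => i%:R * u ^+ i.-1 * taylor_term i f y 0 s) t.
  apply: is_der_eq (is_der_sub D1 (D2 _)) _ => [i _|].
    have := is_der_mul (is_der_pow i t) (is_derive_cst (taylor_term i f y 0 s) t 1).
    by rewrite mulr0 addr0.
  rewrite big_ord_recl mul0r mul0r add0r /dg.
  under [X in _ = X]eq_bigr => j _ do rewrite rV_subE mulrBr.
  rewrite sumrB addr0; congr (_ - _).
  under [RHS]eq_bigr => j _ do rewrite summxE mulr_sumr.
  rewrite exchange_big /=; apply: eq_bigr => i _.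
  rewrite add0n /bump leq0n add1n mxE summxE mulrACA divff ?pnatr_eq0 // mul1r mulr_sumr.
  apply: eq_bigr => j _.
  by rewrite taylor_termZ !mxE; ring.
have gB (t : R) : Num.min 0 1 <= t <= Num.max 0 1 -> `|dg t| <= (\sum_j C j) * rho ^+ k.+1.
  rewrite (min_idPl ler01) (max_idPr ler01) => /andP[t0 t1].
  apply: (le_trans (ler_norm_sum _ _ _)); rewrite mulr_suml; apply: ler_sum => j _.
  have [Cj0 rj0 CP] := CrP j.
  have yj : `|y 0 j| <= rho by have := yrho j; rewrite mxE subr0.
  rewrite normrM exprS mulrCA; apply: ler_pM => //; apply: CP => //.
    by apply: le_trans rhor _; exact: bigmin_le_cond.
  move=> i; rewrite !mxE subr0 normrM ger0_norm //.
  apply: (@le_trans _ _ (1 * `|y 0 i|)); first by rewrite ler_wpM2r.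
  by rewrite mul1r; have := yrho i; rewrite mxE subr0.
have := derivative_bound_lipschitz gD gB.
rewrite subr0 normr1 mulr1; apply: le_trans; rewrite le_eqVlt; apply/orP; left.
apply/eqP; congr (`|_|); rewrite rV_subE summxE /g.
have -> : f (0 *: y + 0) 0 s - \sum_(i < k.+1) 0 ^+ i * taylor_term i f y 0 s = 0.
  rewrite big_ord_recl /= expr0 mul1r big1 ?addr0 ?scale0r ?subrr //.
  by move=> i _; rewrite exprS !mul0r.
rewrite subr0 scale1r addr0; congr (_ - _); apply: eq_bigr => i _.
by rewrite expr1n mul1r.
Qed.

Lemma C1_lipschitz_box n q (f : 'rV[R]_n -> 'rV[R]_q) (p : 'rV[R]_n) (r B : R) :
  Ck 1 f -> (forall j z s, in_box p r z -> `|partial f j z 0 s| <= B) ->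
  forall y y', in_box p r y -> in_box p r y' -> forall s,
  `|f y 0 s - f y' 0 s| <= B * \sum_j `|y 0 j - y' 0 j|.
Proof.
move=> fC1 fB y y' yp y'p s.
apply: (@box_lipschitz _ _ (fun z => f z 0 s) (fun j z => partial f j z 0 s) p r B _ _ _ _ yp y'p).
  exact: (is_derive_partial s fC1).
by move=> j z zp; exact: fB.
Qed.

Lemma C1_locally_lipschitz n q (f : 'rV[R]_n -> 'rV[R]_q) (p : 'rV[R]_n) : Ck 1 f ->
  exists C r, [/\ 0 <= C, 0 < r &
    forall y y', in_box p r y -> in_box p r y' -> forall s,
    `|f y 0 s - f y' 0 s| <= C * \sum_j `|y 0 j - y' 0 j|].
Proof.
move=> fC1.
have H j : \forall z \near p, forall s, `|partial f j z 0 s - partial f j p 0 s| <= 1.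
  by apply: continuous_near_coord => //; exact: Ck_continuous (Ck_partial j fC1).
have /in_box_nbhs[r r0 rP] : \forall z \near p, forall j s,
    `|partial f j z 0 s - partial f j p 0 s| <= 1 by exact: (filter_forall _ H).
pose C := 1 + \sum_j `|partial f j p|.
exists C, r; split=> //; first by rewrite addr_ge0 // sumr_ge0.
apply: C1_lipschitz_box => // j z s zp.
rewrite -[partial f j z 0 s](subrK (partial f j p 0 s)).
apply: le_trans (ler_normD _ _) _; apply: lerD; first exact: rP.
by rewrite (bigD1 j) //= ler_wpDr ?sumr_ge0 //; exact: rV_norm_ge.
Qed.

(** The partial derivatives vanish at 0, so they are bounded by a multiple of the
    distance to 0. *)
Lemma flat_lipschitz n q (f : 'rV[R]_n -> 'rV[R]_q) : Ck 2 f ->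
  (forall j, partial f j 0 = 0) ->
  exists C r, [/\ 0 <= C, 0 < r &
    forall rho y y', 0 <= rho -> rho <= r -> in_box 0 rho y -> in_box 0 rho y' ->
    forall s, `|f y 0 s - f y' 0 s| <= C * rho * \sum_j `|y 0 j - y' 0 j|].
Proof.
move=> fC2 f0.
have /choice[C /choice[r CrP]] : forall j, exists C r, [/\ 0 <= C, 0 < r &
    forall rho y, 0 <= rho -> rho <= r -> in_box 0 rho y -> forall s,
    `|(partial f j y - \sum_(i < 1) taylor_term i (partial f j) y) 0 s| <= C * rho ^+ 1].
  by move=> j; apply: taylor_remainder; exact: Ck_partial.
exists (\sum_j C j), (\big[Num.min/1]_j r j); split.
- by apply: sumr_ge0 => j _; have [] := CrP j.
- by apply: lt_bigmin => // j _; have [] := CrP j.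
move=> rho y y' rho0 rhor yp y'p.
apply: (C1_lipschitz_box (Ck_le (isT : (1 <= 2)%N) fC2) _ yp y'p) => j z s zp.
have [Cj0 rj0 CP] := CrP j.
have rj : rho <= r j by apply: le_trans rhor _; exact: bigmin_le_cond.
have := CP rho z rho0 rj zp s.
rewrite big_ord1 /= f0 subr0 expr1 => H; apply: (le_trans H).
apply: ler_wpM2r => //; rewrite (bigD1 j) //= lerDl sumr_ge0 // => i _.
by have [] := CrP i.
Qed.

End Taylor.

(** * Multi-indices and the formal solution *)

Section MultiIndices.
Context {m : nat}.
Implicit Types chi : multi_index m.

Definition mi_zero : multi_index m := [ffun=> 0%N].

Definition mi_add chi chi' : multi_index m := [ffun j => (chi j + chi' j)%N].

Definition mi_sub chi chi' : multi_index m := [ffun j => (chi j - chi' j)%N].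

Definition mi_le chi chi' : bool := [forall j, (chi j <= chi' j)%N].

Definition mi_below chi : seq (multi_index m) :=
  [seq g <- [seq [ffun j => nat_of_ord (g j)]
               | g : {ffun 'I_m -> 'I_(mi_size chi).+1} <- enum {ffun 'I_m -> 'I_(mi_size chi).+1}] | mi_le g chi].

Lemma mi_leP chi chi' : reflect (forall j, (chi j <= chi' j)%N) (mi_le chi chi').
Proof. exact: forallP. Qed.

Lemma mi_le_refl chi : mi_le chi chi. Proof. exact/mi_leP. Qed.

Lemma mi_le_trans chi1 chi2 chi3 : mi_le chi1 chi2 -> mi_le chi2 chi3 -> mi_le chi1 chi3.
Proof. by move=> /mi_leP h1 /mi_leP h2; apply/mi_leP => j; exact: leq_trans (h2 j). Qed.

Lemma mi_sub_le chi chi' : mi_le (mi_sub chi chi') chi.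
Proof. by apply/mi_leP => j; rewrite ffunE leq_subr. Qed.

Lemma mi_le_add chi chi' : mi_le chi (mi_add chi chi').
Proof. by apply/mi_leP => j; rewrite ffunE leq_addr. Qed.

Lemma mi_subKC chi chi' : mi_le chi' chi -> mi_add chi' (mi_sub chi chi') = chi.
Proof. by move=> /mi_leP h; apply/ffunP => j; rewrite !ffunE subnKC. Qed.

Lemma mi_addK chi chi' : mi_sub (mi_add chi chi') chi = chi'.
Proof. by apply/ffunP => j; rewrite !ffunE addKn. Qed.

Lemma mi_size_sub chi chi' : mi_le chi' chi ->
  mi_size (mi_sub chi chi') = (mi_size chi - mi_size chi')%N.
Proof.
move=> le_chi; rewrite -{2}(mi_subKC le_chi) /mi_size.
rewrite [X in (X - _)%N](eq_bigr (fun j => (chi' j + mi_sub chi chi' j)%N)).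
  by rewrite big_split /= addKn.
by move=> j _; rewrite ffunE.
Qed.

Lemma mi_size_le chi chi' : mi_le chi chi' -> (mi_size chi <= mi_size chi')%N.
Proof. by move=> /mi_leP h; apply: leq_sum => j _. Qed.

Lemma mi_size_eq0 chi : mi_size chi = 0%N -> chi = mi_zero.
Proof.
move=> /eqP; rewrite sum_nat_eq0 => /forallP h; apply/ffunP => j; rewrite ffunE.
by apply/eqP; have := h j.
Qed.

Lemma mi_size0 : mi_size mi_zero = 0%N.
Proof. by rewrite /mi_size big1 // => j _; rewrite ffunE. Qed.

Lemma mi_size_gt0 chi : (0 < mi_size chi)%N = (chi != mi_zero).
Proof.
rewrite lt0n; congr (~~ _); apply/eqP/eqP => [/mi_size_eq0//|->].
exact: mi_size0.
Qed.

Lemma mi_size_lt chi chi' : mi_le chi chi' -> chi != chi' -> (mi_size chi < mi_size chi')%N.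
Proof.
move=> le_chi; apply: contra_neqT; rewrite -leqNgt => le_sz.
have /mi_size_eq0 s0 : mi_size (mi_sub chi' chi) = 0%N.
  by rewrite mi_size_sub //; apply/eqP; rewrite subn_eq0.
rewrite -[RHS](mi_subKC le_chi) s0; apply/ffunP => j; rewrite !ffunE; exact/esym/addn0.
Qed.

Lemma mi_size_unit (i : 'I_m) : mi_size (mi_unit i) = 1%N.
Proof.
rewrite /mi_size (bigD1 i) //= ffunE eqxx big1 // => j ji.
by rewrite ffunE (negPf ji).
Qed.

Lemma mi_size1 chi : mi_size chi = 1%N -> exists i, chi = mi_unit i.
Proof.
move=> sz1; have [i chi_i] : exists i, (0 < chi i)%N.
  apply/existsP; apply: contraPT sz1; rewrite negb_exists => /forallP h.
  by rewrite /mi_size big1 // => j _; apply/eqP; rewrite -leqn0 leqNgt h.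
exists i; apply/esym/eqP; apply/negPn/negP => ne.
have le_chi : mi_le (mi_unit i) chi.
  by apply/mi_leP => j; rewrite ffunE; case: eqVneq => [->|].
by have := mi_size_lt le_chi ne; rewrite sz1 mi_size_unit ltnn.
Qed.

Lemma mem_mi_below chi chi' : (chi' \in mi_below chi) = mi_le chi' chi.
Proof.
rewrite mem_filter andb_idr // => le_chi; apply/mapP.
have lt j : (chi' j < (mi_size chi).+1)%N.
  rewrite ltnS; apply: leq_trans (mi_size_le le_chi).
  by rewrite /mi_size (bigD1 j) //= leq_addr.
exists [ffun j => Ordinal (lt j)]; first by rewrite mem_enum.
by apply/ffunP => j; rewrite !ffunE.
Qed.

Lemma mi_below_uniq chi : uniq (mi_below chi).
Proof.
apply: filter_uniq; rewrite map_inj_uniq ?enum_uniq // => g g' /ffunP E.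
by apply/ffunP => j; apply: val_inj; have := E j; rewrite !ffunE.
Qed.

(** The reindexing that turns the part of a product of two truncated series that
    survives truncation into a truncated series. *)
Lemma sum_cauchy (V : nmodType) (S : seq (multi_index m))
    (H : multi_index m -> multi_index m -> V) : uniq S ->
  (forall chi chi', chi \in S -> mi_le chi' chi -> chi' \in S) ->
  \sum_(chi1 <- S) \sum_(chi2 <- S | mi_add chi1 chi2 \in S) H chi1 chi2 =
  \sum_(chi <- S) \sum_(chi1 <- mi_below chi) H chi1 (mi_sub chi chi1).
Proof.
move=> S_uniq S_down.
transitivity (\sum_(chi <- S) \sum_(chi1 <- S | mi_le chi1 chi) H chi1 (mi_sub chi chi1)).
  rewrite [RHS](exchange_big_dep xpredT) //=; apply: eq_bigr => chi1 _.
  rewrite -big_filter -[RHS]big_filter.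
  set T := [seq chi2 <- S | _].
  transitivity (\sum_(chi <- [seq mi_add chi1 chi2 | chi2 <- T]) H chi1 (mi_sub chi chi1)).
    by rewrite big_map; apply: eq_bigr => chi2 _; rewrite mi_addK.
  apply: perm_big; apply: uniq_perm.
  - rewrite map_inj_uniq ?filter_uniq // => u v /(congr1 (fun x => mi_sub x chi1)).
    by rewrite !mi_addK.
  - exact: filter_uniq.
  move=> chi; rewrite mem_filter; apply/mapP/andP => [[chi2]|[le_chi chiS]].
    by rewrite mem_filter => /andP[h1 h2] ->; rewrite mi_le_add.
  exists (mi_sub chi chi1); last by rewrite mi_subKC.
  by rewrite mem_filter mi_subKC // chiS (S_down chi) // mi_sub_le.
apply: eq_big_seq => chi chiS; rewrite -big_filter; apply: perm_big; apply: uniq_perm.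
- exact: filter_uniq.
- exact: mi_below_uniq.
move=> chi1; rewrite mem_filter mem_mi_below andb_idr // => le_chi.
exact: S_down le_chi.
Qed.

End MultiIndices.

Section TaylorCoefficients.
Context {R : realType} {m : nat}.
Implicit Types chi : multi_index m.

(** The coefficient of z^chi in the k-th Taylor term of f at the formal power
    series with coefficients c. *)
Fixpoint taylor_coef n q (k : nat) (f : 'rV[R]_n -> 'rV[R]_q)
    (c : multi_index m -> 'rV[{poly R}]_n) chi : 'rV[{poly R}]_q :=
  if k is k'.+1 then
    (k%:R^-1)%:P *: \sum_j \sum_(chi1 <- mi_below chi)
      c chi1 0 j *: taylor_coef k' (partial f j) c (mi_sub chi chi1)
  else if chi == mi_zero then (f 0)^P else 0.

Lemma taylor_coef_congr n q k (f : 'rV[R]_n -> 'rV[R]_q) c c' chi :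
  (forall chi', mi_le chi' chi -> c chi' = c' chi') ->
  taylor_coef k f c chi = taylor_coef k f c' chi.
Proof.
elim: k f chi => [|k IHk] f chi //= cc'; congr (_ *: _); apply: eq_bigr => j _.
apply: eq_big_seq => chi1; rewrite mem_mi_below => le_chi; rewrite cc' //.
rewrite IHk // => chi2 /mi_le_trans h; apply: cc'; apply: h; exact: mi_sub_le.
Qed.

(** A nonzero term would have k factors, each with an index of positive size. *)
Lemma taylor_coef_lt n q k (f : 'rV[R]_n -> 'rV[R]_q) c chi :
  c mi_zero = 0 -> (mi_size chi < k)%N -> taylor_coef k f c chi = 0.
Proof.
move=> c0; elim: k f chi => [|k IHk] f chi //= lt_k; rewrite big1 ?scaler0 // => j _.
rewrite big1_seq // => chi1 /andP[_]; rewrite mem_mi_below => le_chi.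
have [->|nz] := eqVneq chi1 mi_zero; first by rewrite c0 mxE scale0r.
rewrite IHk ?scaler0 // mi_size_sub // ltn_subLR ?mi_size_le //.
by rewrite (leq_trans lt_k) // -add1n leq_add2r mi_size_gt0.
Qed.

(** With at least two factors, none of them of index 0, each factor has an index
    strictly below chi. This is what makes the recursion on coefficients well
    founded. *)
Lemma taylor_coef_congr_strict n q k (f : 'rV[R]_n -> 'rV[R]_q) c c' chi : (1 < k)%N ->
  c mi_zero = 0 -> c' mi_zero = 0 ->
  (forall chi', mi_le chi' chi -> chi' != chi -> c chi' = c' chi') ->
  taylor_coef k f c chi = taylor_coef k f c' chi.
Proof.
case: k => [|k] // k0 c0 c'0 cc' /=; congr (_ *: _); apply: eq_bigr => j _.
apply: eq_big_seq => chi1; rewrite mem_mi_below => le_chi.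
have [->|nz] := eqVneq chi1 mi_zero; first by rewrite c0 c'0 mxE !scale0r.
have [->|ne] := eqVneq chi1 chi.
  by rewrite !taylor_coef_lt ?scaler0 // mi_size_sub ?mi_le_refl // subnn.
rewrite cc' //; congr (_ *: _); apply: taylor_coef_congr => chi2 le_chi2.
apply: cc'; first by apply: mi_le_trans le_chi2 _; exact: mi_sub_le.
apply: contraTneq (mi_size_le le_chi2) => ->; rewrite -ltnNge mi_size_sub //.
have s1 : (0 < mi_size chi1)%N by rewrite mi_size_gt0.
by rewrite ltn_subLR ?mi_size_le // -[X in (X < _)%N]add0n ltn_add2r.
Qed.

End TaylorCoefficients.

Section FormalSolution.
Context {R : realType} {m n : nat}.
Variables (lam : 'I_m -> R) (N : 'rV[R]_n -> 'rV[R]_n).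
Variable inv : R -> 'rV[{poly R}]_n -> 'rV[{poly R}]_n.
Implicit Types (chi : multi_index m) (d : 'I_m -> 'rV[{poly R}]_n).

(** For a series c without constant term, Taylor terms of degree greater than the
    size of chi do not contribute, and those of degree 0 and 1 vanish for the
    maps N of interest. Starting at 2 makes [forcing c chi] depend on strictly
    smaller indices only. *)
Definition forcing (c : multi_index m -> 'rV[{poly R}]_n) chi : 'rV[{poly R}]_n :=
  \sum_(2 <= k < (mi_size chi).+1) taylor_coef k N c chi.

Definition linear_coef d chi : 'rV[{poly R}]_n :=
  \sum_i (if chi == mi_unit i then d i else 0).

(** The first argument is fuel for a recursion on the size of the index; any
    value not less than the size gives the same result. *)
Fixpoint formal_step (k : nat) d chi : 'rV[{poly R}]_n :=
  if (mi_size chi <= 1)%N then linear_coef d chi else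
  if k is k'.+1 then inv (mi_dot lam chi) (forcing (formal_step k' d) chi) else 0.

Definition formal_solution d chi := formal_step (mi_size chi) d chi.

Lemma linear_coef_unit d i : linear_coef d (mi_unit i) = d i.
Proof.
rewrite /linear_coef (bigD1 i) //= eqxx big1 ?addr0 // => j ji.
case: eqVneq => // /ffunP /(_ i); rewrite !ffunE eqxx.
by rewrite [i == j]eq_sym (negPf ji).
Qed.

Lemma formal_step_small k d chi : (mi_size chi <= 1)%N ->
  formal_step k d chi = linear_coef d chi.
Proof. by case: k => [|k] /= ->. Qed.

Lemma formal_step0 k d : formal_step k d mi_zero = 0.
Proof.
rewrite formal_step_small ?mi_size0 // /linear_coef big1 // => i _.
by case: eqVneq => // /(congr1 (@mi_size m)); rewrite mi_size0 mi_size_unit.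
Qed.

Lemma forcing_congr c c' chi : c mi_zero = 0 -> c' mi_zero = 0 ->
  (forall chi', mi_le chi' chi -> chi' != chi -> c chi' = c' chi') ->
  forcing c chi = forcing c' chi.
Proof.
move=> c0 c'0 cc'; apply: eq_big_nat => k /andP[k2 _].
exact: taylor_coef_congr_strict.
Qed.

Lemma formal_step_stable k d chi : (mi_size chi <= k)%N ->
  formal_step k d chi = formal_solution d chi.
Proof.
have [b] := ubnP (mi_size chi); elim: b chi k => // b IHb chi k szb szk.
have [sz1|sz2] := leqP (mi_size chi) 1.
  by rewrite /formal_solution !formal_step_small.
rewrite /formal_solution; case: k szk sz2 => [|k] szk sz2.
  by move: sz2; rewrite ltnNge (leq_trans szk).
case E : (mi_size chi) => [|s]; first by rewrite E in sz2.
rewrite /= E; case: ifP => // _; congr (inv _ _).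
apply: forcing_congr; rewrite ?formal_step0 // => chi' le_chi ne.
have lt_sz := mi_size_lt le_chi ne.
have szs : (mi_size chi' <= s)%N by rewrite -ltnS -E.
by rewrite !IHb // ?(leq_trans lt_sz) // (leq_trans szs) // -ltnS -E.
Qed.

Lemma formal_solution0 d : formal_solution d mi_zero = 0.
Proof. exact: formal_step0. Qed.

Lemma formal_solution_unit d i : formal_solution d (mi_unit i) = d i.
Proof. by rewrite /formal_solution formal_step_small ?mi_size_unit // linear_coef_unit. Qed.

Lemma formal_solution_rec d chi : (1 < mi_size chi)%N ->
  formal_solution d chi = inv (mi_dot lam chi) (forcing (formal_solution d) chi).
Proof.
move=> sz; rewrite {1}/formal_solution.
case E : (mi_size chi) => [|s]; first by rewrite E in sz.
rewrite /= leqNgt sz /=; congr (inv _ _).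
apply: forcing_congr; rewrite ?formal_step0 ?formal_solution0 // => chi' le_chi ne.
by apply: formal_step_stable; rewrite -ltnS -E mi_size_lt.
Qed.

(** Indices below chi have their support inside that of chi. *)
Lemma formal_solution_supp d d' chi : (forall i, (0 < chi i)%N -> d i = d' i) ->
  formal_solution d chi = formal_solution d' chi.
Proof.
have [b] := ubnP (mi_size chi); elim: b chi => // b IHb chi szb dd'.
have [sz1|sz2] := leqP (mi_size chi) 1.
  rewrite /formal_solution !formal_step_small //; apply: eq_bigr => i _.
  by case: eqVneq => // E; apply: dd'; rewrite E ffunE eqxx.
rewrite !formal_solution_rec //; congr (inv _ _).
apply: forcing_congr; rewrite ?formal_solution0 // => chi' le_chi ne.
apply: IHb; first by rewrite -ltnS (leq_trans _ szb) // ltnS mi_size_lt.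
by move=> i chi'i; apply: dd'; apply: leq_trans chi'i _; exact/mi_leP.
Qed.

End FormalSolution.

(** * Truncated expansions *)

Section Evaluation.
Context {R : realType}.

Lemma pval0 n t : pval (0 : 'rV[{poly R}]_n) t = 0.
Proof. by apply/rowP => s; rewrite pvalE !mxE horner0. Qed.

Lemma pvalD n (p q : 'rV[{poly R}]_n) t : pval (p + q) t = pval p t + pval q t.
Proof. by apply/rowP => s; rewrite !(pvalE, mxE) hornerD. Qed.

Lemma pvalB n (p q : 'rV[{poly R}]_n) t : pval (p - q) t = pval p t - pval q t.
Proof. by apply/rowP => s; rewrite !(pvalE, mxE) hornerD hornerN. Qed.

Lemma pvalZ n (q : {poly R}) (p : 'rV[{poly R}]_n) t : pval (q *: p) t = q.[t] *: pval p t.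
Proof. by apply/rowP => s; rewrite !(pvalE, mxE) hornerM. Qed.

Lemma pval_sum n (I : Type) (r : seq I) (P : pred I) (F : I -> 'rV[{poly R}]_n) t :
  pval (\sum_(i <- r | P i) F i) t = \sum_(i <- r | P i) pval (F i) t.
Proof.
by elim/big_rec2: _ => [|i u v _ <-]; [exact: pval0|exact: pvalD].
Qed.

Lemma pval_polyC n (v : 'rV[R]_n) t : pval v^P t = v.
Proof. by apply/rowP => s; rewrite pvalE mxE hornerC. Qed.

End Evaluation.

Section Expansions.
Context {R : realType} {m : nat}.
Variables (lam : 'I_m -> R) (a : R).
Hypotheses (a0 : 0 < a) (a_lam : forall i, a <= lam i).
Implicit Types chi : multi_index m.

Let lam0 i : 0 < lam i. Proof. exact: lt_le_trans (a_lam i). Qed.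

Lemma mi_dot_add chi chi' : mi_dot lam (mi_add chi chi') = mi_dot lam chi + mi_dot lam chi'.
Proof.
by rewrite /mi_dot -big_split /=; apply: eq_bigr => j _; rewrite ffunE natrD mulrDl.
Qed.

Lemma mi_dot0 : mi_dot lam mi_zero = 0.
Proof. by rewrite /mi_dot big1 // => j _; rewrite ffunE mul0r. Qed.

Lemma mi_dot_unit i : mi_dot lam (mi_unit i) = lam i.
Proof.
rewrite /mi_dot (bigD1 i) //= ffunE eqxx mul1r big1 ?addr0 // => j ji.
by rewrite ffunE (negPf ji) mul0r.
Qed.

Lemma mi_dot_ge0 chi : 0 <= mi_dot lam chi.
Proof. by apply: sumr_ge0 => j _; rewrite mulr_ge0 // ltW. Qed.

Lemma mi_dot_le chi chi' : mi_le chi chi' -> mi_dot lam chi <= mi_dot lam chi'.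
Proof. by move=> h; rewrite -(mi_subKC h) mi_dot_add lerDl mi_dot_ge0. Qed.

Lemma mi_dot_ge chi : a * (mi_size chi)%:R <= mi_dot lam chi.
Proof.
rewrite /mi_size /mi_dot natr_sum mulr_sumr; apply: ler_sum => j _.
by rewrite mulrC ler_wpM2l.
Qed.

Definition index_list (theta : R) : seq (multi_index m) :=
  finmap.enum_fset (fset_set (I_ lam theta)).

Lemma mem_index_list theta chi : (chi \in index_list theta) = (mi_dot lam chi <= theta).
Proof.
rewrite /index_list in_fset_set; last exact: finite_I_.
by apply/idP/idP => [|h]; rewrite inE.
Qed.

Lemma index_list_uniq theta : uniq (index_list theta).
Proof. exact: finmap.fset_uniq. Qed.

Lemma index_list_down theta chi chi' : chi \in index_list theta -> mi_le chi' chi ->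
  chi' \in index_list theta.
Proof. by rewrite !mem_index_list => h /mi_dot_le /le_trans; apply. Qed.

Definition expansion n (c : multi_index m -> 'rV[{poly R}]_n) (theta t : R) : 'rV[R]_n :=
  \sum_(chi <- index_list theta) expR (- mi_dot lam chi * t) *: pval (c chi) t.

Lemma expansionE n (c : multi_index m -> 'rV[{poly R}]_n) theta t s :
  expansion c theta t 0 s =
  \sum_(chi \in I_ lam theta) (c chi 0 s).[t] * expR (- mi_dot lam chi * t).
Proof.
rewrite /expansion summxE fsbig_finite /=; last exact: finite_I_.
by apply: eq_bigr => chi _; rewrite mxE pvalE mulrC.
Qed.

Lemma expansion_small n (c : multi_index m -> 'rV[{poly R}]_n) theta eta :
  (forall chi, mi_dot lam chi < eta -> c chi = 0) -> vsmall eta (expansion c theta).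
Proof.
move=> c0; apply: vsmall_sum => chi _; have [/c0 ->|h] := ltP (mi_dot lam chi) eta.
  by apply: vsmall_eq (@vsmall0 _ _ _) => t _; rewrite pval0 scaler0.
exact: (vsmall_le h (@vsmall_exppoly _ _ _ _)).
Qed.

Lemma expansionB n (c c' : multi_index m -> 'rV[{poly R}]_n) theta t :
  expansion (fun chi => c chi - c' chi) theta t = expansion c theta t - expansion c' theta t.
Proof.
by rewrite /expansion -sumrB /=; apply: eq_bigr => chi _; rewrite pvalB scalerBr.
Qed.

Lemma expansionZ n (k : R) (c : multi_index m -> 'rV[{poly R}]_n) theta t :
  expansion (fun chi => k%:P *: c chi) theta t = k *: expansion c theta t.
Proof.
rewrite /expansion scaler_sumr; apply: eq_bigr => chi _.
by rewrite pvalZ hornerC !scalerA mulrC.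
Qed.

Lemma expansion_sum n (I : finType) (c : I -> multi_index m -> 'rV[{poly R}]_n) theta t :
  expansion (fun chi => \sum_i c i chi) theta t = \sum_i expansion (c i) theta t.
Proof.
rewrite /expansion exchange_big /=; apply: eq_bigr => chi _.
by rewrite pval_sum scaler_sumr.
Qed.

Lemma expansion_sub_trunc n (c : multi_index m -> 'rV[{poly R}]_n) theta theta' t :
  theta <= theta' -> expansion c theta' t - expansion c theta t =
  \sum_(chi <- index_list theta' | theta < mi_dot lam chi)
    expR (- mi_dot lam chi * t) *: pval (c chi) t.
Proof.
move=> le_th; rewrite /expansion (bigID (fun chi => mi_dot lam chi <= theta)) /=.
rewrite -big_filter [X in X + _ - _](perm_big (index_list theta)) /=; last first.
  apply: uniq_perm; rewrite ?filter_uniq ?index_list_uniq // => chi.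
  rewrite mem_filter !mem_index_list andb_idr // => h; exact: le_trans le_th.
by rewrite addrC addKr; apply: eq_bigl => chi; rewrite -ltNge.
Qed.

Lemma expansion_trunc n (c : multi_index m -> 'rV[{poly R}]_n) theta theta' :
  theta <= theta' -> vsmall theta (fun t => expansion c theta' t - expansion c theta t).
Proof.
move=> le_th; apply: vsmall_eq (fun t _ => expansion_sub_trunc c t le_th) _.
by apply: vsmall_sum => chi /ltW h; exact: (vsmall_le h (@vsmall_exppoly _ _ _ _)).
Qed.

Lemma expansion_trunc_o_exp n (c : multi_index m -> 'rV[{poly R}]_n) theta theta' s :
  theta <= theta' -> o_exp theta (fun t => (expansion c theta' t - expansion c theta t) 0 s).
Proof.
move=> le_th; pose f chi t := (expR (- mi_dot lam chi * t) *: pval (c chi) t) 0 s.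
apply: (@o_exp_ext _ _ _
  (fun t => \sum_(chi <- index_list theta' | theta < mi_dot lam chi) f chi t)).
  by move=> t; rewrite expansion_sub_trunc // summxE.
apply: o_exp_sum => chi h; apply: exp_small_o_exp h _.
exact: (@vsmall_exppoly _ _ _ _ s).
Qed.

(** Multiplying two truncated expansions produces the truncated product and
    terms whose index has weight greater than theta. *)
Lemma expansion_mul n (g : multi_index m -> {poly R}) (e : multi_index m -> 'rV[{poly R}]_n)
    theta :
  vsmall theta (fun t =>
    (\sum_(chi <- index_list theta) expR (- mi_dot lam chi * t) * (g chi).[t])
      *: expansion e theta t -
    expansion (fun chi => \sum_(chi1 <- mi_below chi) g chi1 *: e (mi_sub chi chi1)) theta t).
Proof.
pose S := index_list theta.
pose H t chi1 chi2 := expR (- mi_dot lam (mi_add chi1 chi2) * t) *: pval (g chi1 *: e chi2) t.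
have E t : (\sum_(chi <- S) expR (- mi_dot lam chi * t) * (g chi).[t]) *: expansion e theta t -
    expansion (fun chi => \sum_(chi1 <- mi_below chi) g chi1 *: e (mi_sub chi chi1)) theta t =
    \sum_(chi1 <- S) \sum_(chi2 <- S | mi_add chi1 chi2 \notin S) H t chi1 chi2.
  apply/eqP; rewrite subr_eq; apply/eqP.
  transitivity (\sum_(chi1 <- S) \sum_(chi2 <- S) H t chi1 chi2).
    rewrite scaler_suml; apply: eq_bigr => chi1 _.
    rewrite /expansion scaler_sumr; apply: eq_bigr => chi2 _.
    rewrite /H pvalZ mi_dot_add opprD mulrDl expRD !scalerA; congr (_ *: _).
    by ring.
  have -> : expansion (fun chi => \sum_(chi1 <- mi_below chi) g chi1 *: e (mi_sub chi chi1)) theta t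
      = \sum_(chi1 <- S) \sum_(chi2 <- S | mi_add chi1 chi2 \in S) H t chi1 chi2.
    rewrite sum_cauchy; [|exact: index_list_uniq|exact: index_list_down].
    apply: eq_bigr => chi _; rewrite pval_sum scaler_sumr.
    by apply: eq_big_seq => chi1; rewrite mem_mi_below /H => /mi_subKC ->.
  rewrite -big_split /=; apply: eq_bigr => chi1 _.
  by rewrite (bigID (fun chi2 => mi_add chi1 chi2 \in S)) /= addrC.
apply: (vsmall_eq (fun t _ => E t)); apply: vsmall_sum => chi1 _.
apply: vsmall_sum => chi2; rewrite mem_index_list -ltNge => /ltW h.
exact: (vsmall_le h (@vsmall_exppoly _ _ _ _)).
Qed.

Lemma taylor_term_expansion n q k (f : 'rV[R]_n -> 'rV[R]_q)
    (c : multi_index m -> 'rV[{poly R}]_n) theta : 0 <= theta ->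
  vsmall theta (fun t => taylor_term k f (expansion c theta t) -
                         expansion (taylor_coef k f c) theta t).
Proof.
move=> th0; elim: k f => [|k IHk] f.
  apply: vsmall_eq (@vsmall0 _ _ _) => t _ /=.
  rewrite /expansion (bigD1_seq mi_zero) ?index_list_uniq ?mem_index_list ?mi_dot0 //=.
  rewrite eqxx oppr0 mul0r expR0 scale1r pval_polyC big1 ?addr0 ?subrr // => chi ne.
  by rewrite (negPf ne) pval0 scaler0.
pose e j chi := \sum_(chi1 <- mi_below chi) c chi1 0 j *: taylor_coef k (partial f j) c (mi_sub chi chi1).
pose A := expansion c theta.
have As j : exp_small 0 (fun t => A t 0 j).
  by have := @expansion_small _ c theta 0; apply => chi; rewrite ltNge mi_dot_ge0.
have AE j t : A t 0 j = \sum_(chi <- index_list theta) expR (- mi_dot lam chi * t) * (c chi 0 j).[t].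
  by rewrite /A /expansion summxE; apply: eq_bigr => chi _; rewrite mxE pvalE.
have H j : vsmall theta (fun t => A t 0 j *: taylor_term k (partial f j) (A t) - expansion (e j) theta t).
  have h1 := vsmallZ (As j) (IHk (partial f j)); rewrite add0r in h1.
  have h2 := @expansion_mul _ (fun chi => c chi 0 j) (taylor_coef k (partial f j) c) theta.
  apply: vsmall_eq (vsmallD h1 h2) => t _; rewrite -AE scalerBr addrA subrK.
  by [].
have := vsmallZ (exp_small_cst k.+1%:R^-1) (vsmall_sum (index_enum _) (fun j (_ : true) => H j)).
rewrite add0r; apply: vsmall_eq => t _.
rewrite /= expansionZ expansion_sum -scalerBr -sumrB.
by [].
Qed.

End Expansions.

(** * The formal solution as an approximate solution *)

Section NonlinearEstimates.
Context {R : realType}.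

Lemma vsmall_near_box n (y : R -> 'rV[R]_n) (a r : R) : r < a -> vsmall a y ->
  \forall t \near +oo, in_box 0 (expR (- r * t)) (y t).
Proof.
move=> ra ys.
have H j : \forall t \near +oo, `|y t 0 j| <= expR (- r * t) by exact: ys.
apply: filterS (filter_forall _ H) => t h j.
by rewrite mxE subr0; exact: h.
Qed.

Lemma expR_near_le (r e : R) : 0 < r -> 0 < e -> \forall t \near +oo, expR (- r * t) <= e.
Proof.
move=> r0 e0; have := exp_small_cvg0 r0 (exp_small_expR r).
move/cvgr0Pnorm_le => /(_ e e0); apply: filterS => t.
by rewrite ger0_norm // expR_ge0.
Qed.

(** If y is of order a, a bound by the K-th power of the norm of y is of order a K. *)
Lemma taylor_remainder_small n q K (f : 'rV[R]_n -> 'rV[R]_q) (y : R -> 'rV[R]_n) (a : R) :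
  0 < a -> Ck K f -> vsmall a y ->
  vsmall (a * K%:R) (fun t => f (y t) - \sum_(k < K) taylor_term k f (y t)).
Proof.
move=> a0 fK ys s r' r'lt; have [C [r0 [C0 r00 rem]]] := taylor_remainder fK.
(* r is positive, below a, and r K exceeds r' *)
pose r := (Num.max (r' / K%:R) 0 + a) / 2.
have max0 : 0 <= Num.max (r' / K%:R) 0 by rewrite le_max lexx orbT.
have maxa : Num.max (r' / K%:R) 0 < a.
  rewrite gt_max a0 andbT; case: (posnP K) => [->|K0]; first by rewrite invr0 mulr0.
  by rewrite ltr_pdivrMr ?ltr0n.
have rpos : 0 < r by rewrite /r; lra.
have ra : r < a by rewrite /r; lra.
have rr' : r' < r * K%:R.
  case: (posnP K) r'lt => [->|K0 _]; first by rewrite !mulr0.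
  rewrite -ltr_pdivrMr ?ltr0n //.
  have : r' / K%:R <= Num.max (r' / K%:R) 0 by rewrite le_max lexx.
  by rewrite /r; lra.
suff : exp_small (r * K%:R) (fun t => (f (y t) - \sum_(k < K) taylor_term k f (y t)) 0 s) by exact.
apply: (exp_small_dom _ (exp_smallZ C (exp_small_expR (r * K%:R)))).
near=> t.
apply: le_trans (rem (expR (- r * t)) (y t) _ _ _ s) _.
- exact: expR_ge0.
- by near: t; exact: expR_near_le.
- by near: t; exact: vsmall_near_box ys.
rewrite [leRHS]ger0_norm ?mulr_ge0 ?expR_ge0 // -expRM_natl.
by rewrite le_eqVlt; apply/orP; left; apply/eqP; congr (_ * expR _); ring.
Unshelve. all: by end_near. Qed.

(** The Lipschitz constant of f near y and z is itself of order a. *)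
Lemma flat_difference_small n (f : 'rV[R]_n -> 'rV[R]_n) (y z : R -> 'rV[R]_n) (a theta : R) :
  0 < a -> Ck 2 f -> (forall j, partial f j 0 = 0) ->
  vsmall a y -> vsmall a z -> vsmall theta (fun t => y t - z t) ->
  vsmall (a + theta) (fun t => f (y t) - f (z t)).
Proof.
move=> a0 fC2 f0 ys zs yzs s r' r'lt.
have [C [r0 [C0 r00 lip]]] := flat_lipschitz fC2 f0.
(* r is positive, below a, and r + theta exceeds r' *)
pose r := Num.max (a - (a + theta - r') / 2) (a / 2).
have r1 : a - (a + theta - r') / 2 <= r by rewrite le_max lexx.
have r2 : a / 2 <= r by rewrite le_max lexx orbT.
have rpos : 0 < r by lra.
have ra : r < a by rewrite gt_max; apply/andP; split; lra.
have normS j : exp_small theta (fun t => `|(y t - z t) 0 j|).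
  by apply: exp_small_dom (yzs j); near=> t; rewrite normr_id.
have := exp_smallZ C (exp_smallM (exp_small_expR r)
  (exp_small_sum (index_enum _) (fun j (_ : true) => normS j))).
move=> H; suff : exp_small (r + theta) (fun t => (f (y t) - f (z t)) 0 s) by apply; lra.
apply: exp_small_dom H; near=> t.
rewrite rV_subE; apply: le_trans (lip (expR (- r * t)) (y t) (z t) _ _ _ _ s) _.
- exact: expR_ge0.
- by near: t; exact: expR_near_le.
- by near: t; exact: vsmall_near_box ys.
- by near: t; exact: vsmall_near_box zs.
apply: le_trans (ler_norm _); rewrite -mulrA.
rewrite (eq_bigr (fun j => `|(y t - z t) 0 j|)) // => j _.
by rewrite rV_subE.
Unshelve. all: by end_near. Qed.

End NonlinearEstimates.

Section FormalResidual.
Context {R : realType} {m n : nat}.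
Variables (lam : 'I_m -> R) (a : R) (N : 'rV[R]_n -> 'rV[R]_n) (A : 'M[R]_n).
Hypotheses (a0 : 0 < a) (a_lam : forall i, a <= lam i).
Hypotheses (N_smooth : smooth N) (N0 : N 0 = 0) (dN0 : forall j, partial N j 0 = 0).
Implicit Types chi : multi_index m.

Lemma forcingE (c : multi_index m -> 'rV[{poly R}]_n) chi K :
  c mi_zero = 0 -> (mi_size chi < K)%N ->
  \sum_(k < K) taylor_coef k N c chi = forcing N c chi.
Proof.
move=> c0 szK; rewrite /forcing -(big_mkord xpredT (fun k => taylor_coef k N c chi)).
rewrite [RHS](big_nat_widenl _ 0) // [RHS](big_nat_widen _ _ K) // [RHS]big_mkcond /=.
apply: eq_big_nat => k kK; case: ifP => // /negbT; rewrite negb_and -!leqNgt.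
move=> /orP[k1|szk]; last exact: taylor_coef_lt.
case: k k1 {kK} => [|[|//]] _ /=; first by rewrite N0 map_mx0 if_same.
rewrite big1 ?scaler0 // => j _; rewrite big1 // => chi1 _.
by rewrite dN0 map_mx0 if_same scaler0.
Qed.

Lemma expansion_small_rate (c : multi_index m -> 'rV[{poly R}]_n) theta :
  c mi_zero = 0 -> vsmall a (expansion lam c theta).
Proof.
move=> c0; apply: expansion_small => chi h; have [->//|nz] := eqVneq chi mi_zero.
have := mi_dot_ge a_lam chi; rewrite leNgt (lt_le_trans h) //.
by rewrite ler_peMr ?(ltW a0) // ler1n mi_size_gt0.
Qed.

(** Composing N with the truncated expansion agrees, up to order theta, with
    truncating the formal composition: only Taylor terms of degree below K
    matter when a K exceeds theta. *)
Lemma expansion_composition (c : multi_index m -> 'rV[{poly R}]_n) theta :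
  c mi_zero = 0 -> 0 <= theta ->
  vsmall theta (fun t => N (expansion lam c theta t) - expansion lam (forcing N c) theta t).
Proof.
move=> c0 th0; pose K := Num.bound (theta / a).
have thK : theta < a * K%:R.
  by rewrite mulrC -ltr_pdivrMr // archi_boundP // divr_ge0 // ltW.
have As := expansion_small_rate theta c0.
have h1 := vsmall_le (ltW thK) (taylor_remainder_small a0 (N_smooth K) As).
have h2 := vsmall_sum (index_enum 'I_K) (fun k (_ : true) =>
  taylor_term_expansion a0 a_lam k N c th0).
apply: vsmall_eq (vsmallD h1 h2) => t _; rewrite sumrB addrA subrK; congr (_ - _).
rewrite -expansion_sum; apply: eq_big_seq => chi.
rewrite (mem_index_list a0 a_lam) => chiS; rewrite forcingE //.
rewrite -(ltr_nat R); have h := mi_dot_ge a_lam chi.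
by rewrite -(ltr_pM2l a0); apply: le_lt_trans h _; exact: le_lt_trans thK.
Qed.

Variable inv : R -> 'rV[{poly R}]_n -> 'rV[{poly R}]_n.
Hypothesis invP : forall mu F, pderiv (inv mu F) = inv mu F *m (A + mu%:M)^P + F.

Lemma formal_solutionE d : (forall i, pderiv (d i) = d i *m (A + (lam i)%:M)^P) ->
  let c := formal_solution lam N inv d in
  forall chi, pderiv (c chi) = c chi *m (A + (mi_dot lam chi)%:M)^P + forcing N c chi.
Proof.
move=> dD c chi; have [sz1|sz2] := leqP (mi_size chi) 1; last first.
  by rewrite /c formal_solution_rec // invP.
rewrite [forcing _ _ _]big_geq ?addr0 //.
case E : (mi_size chi) sz1 => [|[|//]] _.
  rewrite (mi_size_eq0 E) /c formal_solution0 mul0mx.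
  by apply/rowP => s; rewrite !mxE deriv0.
have [i ->] := mi_size1 E.
by rewrite /c formal_solution_unit mi_dot_unit dD.
Qed.

Lemma expansion_residual d theta : 0 <= theta ->
  (forall i, pderiv (d i) = d i *m (A + (lam i)%:M)^P) ->
  let c := formal_solution lam N inv d in
  exists2 r, vsmall theta r &
    vderiv (expansion lam c theta)
      (fun t => expansion lam c theta t *m A + N (expansion lam c theta t) + r t).
Proof.
move=> th0 dD c; have cD := formal_solutionE dD; rewrite -/c in cD.
have c0 : c mi_zero = 0 by exact: formal_solution0.
exists (fun t => expansion lam (forcing N c) theta t - N (expansion lam c theta t)).
  apply: vsmall_eq (vsmallN (expansion_composition c0 th0)) => t _.
  by rewrite opprB.
have eD chi : vderiv (fun t => expR (- mi_dot lam chi * t) *: pval (c chi) t)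
    (fun t => expR (- mi_dot lam chi * t) *: (pval (c chi) t *m A + pval (forcing N c chi) t)).
  apply: vderiv_eq (vderiv_expR _ (vderiv_pval _)) _ => t _; congr (_ *: _).
  rewrite cD pvalD pval_mulC mulmxDr mul_mx_scalar scaleNr.
  by rewrite [X in _ + (X + _)]addrC -addrA addKr.
apply: vderiv_eq (vderiv_sum (index_list lam theta) (fun chi (_ : true) => eD chi)) _ => t _.
rewrite -[RHS]addrA [X in _ = _ + X]addrC subrK /expansion mulmx_suml -big_split /=.
by apply: eq_bigr => chi _; rewrite -scalemxAl scalerDr.
Qed.

End FormalResidual.

(** * Improving the order of approximation *)

Section Bootstrap.
Context {R : realType} {m n : nat}.
Variables (lam : 'I_m -> R) (a : R) (N : 'rV[R]_n.+1 -> 'rV[R]_n.+1) (A : 'M[R]_n.+1).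
Variable inv : R -> 'rV[{poly R}]_n.+1 -> 'rV[{poly R}]_n.+1.
Variable k : nat.
Hypotheses (a0 : 0 < a) (a_lam : forall i, a <= lam i) (lam_inj : injective lam).
Hypotheses (N_smooth : smooth N) (N0 : N 0 = 0) (dN0 : forall j, partial N j 0 = 0).
Hypothesis invP : forall mu F, pderiv (inv mu F) = inv mu F *m (A + mu%:M)^P + F.
Hypothesis A_split :
  horner_mx A (\prod_(i <- enum 'I_m) ('X - (- lam i)%:P) ^+ k) = 0.
Implicit Types (chi : multi_index m) (d e : 'I_m -> 'rV[{poly R}]_n.+1).

(** Equivalently, exp(- lam_i t) d_i(t) solves the linear equation. *)
Definition admissible d := forall i, pderiv (d i) = d i *m (A + (lam i)%:M)^P.

Local Notation coefs d := (formal_solution lam N inv d).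
Local Notation approx d := (expansion lam (coefs d)).

(** A linear term left out by the truncation has weight greater than theta. *)
Lemma linear_coef_expansion e theta :
  vsmall theta (fun t => \sum_(i <- enum 'I_m) expR (- lam i * t) *: pval (e i) t -
                         expansion lam (linear_coef e) theta t).
Proof.
have E t : expansion lam (linear_coef e) theta t =
    \sum_(i <- enum 'I_m) expansion lam (fun chi => if chi == mi_unit i then e i else 0) theta t.
  by rewrite expansion_sum big_enum.
have H (i : 'I_m) : true -> vsmall theta (fun t => expR (- lam i * t) *: pval (e i) t -
    expansion lam (fun chi => if chi == mi_unit i then e i else 0) theta t).
  move=> _; have [iS|iS] := boolP (mi_unit i \in index_list lam theta).
    apply: vsmall_eq (@vsmall0 _ _ _) => t _.
    rewrite /expansion (bigD1_seq (mi_unit i)) ?index_list_uniq //= eqxx mi_dot_unit.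
    rewrite big1 ?addr0 ?subrr // => chi ne.
    by rewrite (negPf ne) pval0 scaler0.
  apply: (@vsmall_eq _ _ _ _ (fun t => expR (- lam i * t) *: pval (e i) t)).
    move=> t _; rewrite /expansion big1_seq ?subr0 // => chi /andP[_ chiS].
    by case: eqVneq => [E'|]; [rewrite -E' chiS in iS|rewrite pval0 scaler0].
  rewrite (mem_index_list a0 a_lam) mi_dot_unit -ltNge in iS.
  exact: (vsmall_le (ltW iS) (@vsmall_exppoly _ _ _ _)).
by apply: vsmall_eq (vsmall_sum _ H) => t _; rewrite E sumrB.
Qed.

(** If d_i is modified only when lam_i >= theta, an index chi with |chi| > 1
    that sees the change has weight at least lam_i + a. *)
Lemma formal_solution_perturb d e theta chi : (forall i, lam i < theta -> e i = 0) ->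
  mi_dot lam chi < theta + a ->
  coefs (fun i => d i + e i) chi - coefs d chi - linear_coef e chi = 0.
Proof.
move=> e0 lt_chi; have [sz1|sz2] := leqP (mi_size chi) 1.
  case E : (mi_size chi) sz1 => [|[|//]] _.
    rewrite (mi_size_eq0 E) !formal_solution0 subrr sub0r.
    rewrite -(formal_step_small lam N inv 0) ?mi_size0 //.
    by rewrite formal_step0 oppr0.
  have [i ->] := mi_size1 E.
  by rewrite !formal_solution_unit linear_coef_unit [d i + _]addrC addrK subrr.
have -> : linear_coef e chi = 0.
  rewrite /linear_coef big1 // => i _; case: eqVneq => // E.
  by rewrite E mi_size_unit in sz2.
rewrite subr0; apply/eqP; rewrite subr_eq0; apply/eqP; apply: formal_solution_supp => i chi_i.
rewrite e0 ?addr0 //.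
(* chi = mi_unit i + rest with rest nonzero, and each index weighs at least a *)
have le_chi : mi_le (mi_unit i) chi.
  by apply/mi_leP => j; rewrite ffunE; case: eqVneq => [->|].
rewrite -(mi_subKC le_chi) mi_dot_add mi_dot_unit in lt_chi.
rewrite -(ltrD2r a); apply: le_lt_trans lt_chi; rewrite lerD2l.
apply: le_trans (mi_dot_ge a_lam _); rewrite ler_peMr ?(ltW a0) // ler1n.
by rewrite mi_size_sub // mi_size_unit subn_gt0.
Qed.

(** The difference between x and the longer truncation solves a linear equation
    whose right-hand side is better by the order a; its leading terms become
    the correction of d. *)
Lemma bootstrap_step d theta (x : R -> 'rV[R]_n.+1) :
  admissible d -> 0 <= theta ->
  vderiv x (fun t => x t *m A + N (x t)) -> vsmall a x ->
  vsmall theta (fun t => x t - approx d theta t) ->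
  exists d', [/\ admissible d', forall i, lam i < theta -> d' i = d i &
    vsmall (theta + a) (fun t => x t - approx d' (theta + a) t)].
Proof.
move=> dD th0 xD xs us; pose theta' := theta + a.
have th0' : 0 <= theta' by rewrite addr_ge0 // ltW.
pose y := approx d theta'.
have [r rs yD] := expansion_residual a0 a_lam N_smooth N0 dN0 invP th0' dD.
have ys : vsmall a y.
  by apply: expansion_small_rate => //; exact: formal_solution0.
have uS : vsmall theta (fun t => x t - y t).
  have le_th : theta <= theta' by rewrite lerDl ltW.
  apply: vsmall_eq (vsmallB us (expansion_trunc a0 a_lam (coefs d) le_th)) => t _.
  by rewrite opprB addrA subrK.
pose h t := N (x t) - N (y t) - r t.
have hs : vsmall theta' h.
  apply: vsmallB => //; rewrite /theta' addrC.
  exact: (flat_difference_small a0 (N_smooth 2) dN0 xs ys uS).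
have uD : vderiv (fun t => x t - y t) (fun t => (x t - y t) *m A + h t).
  apply: vderiv_eq (vderivB xD yD) _ => t _; rewrite /h mulmxBl.
  by rewrite -/(y t) !opprD !addrA [_ + N (x t) - _]addrAC.
have [e [eD eth es]] := linear_asymptotics lam_inj (enum_uniq _) uD uS hs
  (fun t _ => etrans (congr1 (mulmx _) A_split) (mulmx0 _ _)).
exists (fun i => d i + e i); split=> [i|i lt_i|].
- by rewrite mulmxDl -dD -eD; apply/rowP => s; rewrite !mxE derivD.
- by rewrite eth ?addr0.
pose rho chi := coefs (fun i => d i + e i) chi - coefs d chi - linear_coef e chi.
have rhos : vsmall theta' (expansion lam rho theta').
  by apply: expansion_small => chi; exact: formal_solution_perturb.
apply: vsmall_eq (vsmallB (vsmallD es (@linear_coef_expansion e theta')) rhos) => t _.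
rewrite addrA subrK /rho !expansionB /y.
set p := approx _ _ _; set q := approx _ _ _; set l := expansion _ _ _ _.
rewrite opprB [l - _]addrC -addrA opprB.
by apply/rowP => s; rewrite !mxE; ring.
Qed.

Lemma bootstrap (x : R -> 'rV[R]_n.+1) :
  vderiv x (fun t => x t *m A + N (x t)) -> vsmall a x ->
  exists d, forall theta, exists2 theta', theta < theta' &
    vsmall theta' (fun t => x t - approx d theta' t).
Proof.
move=> xD xs.
have rateS j : a * j.+1%:R + a = a * j.+2%:R.
  by rewrite -[X in _ + X]mulr1 -mulrDr natr1.
have iter j : exists2 d, admissible d &
    vsmall (a * j.+1%:R) (fun t => x t - approx d (a * j.+1%:R) t).
  elim: j => [|j [d dD ds]].
    exists (fun=> 0); first by move=> i; rewrite mul0mx; apply/rowP => s; rewrite !mxE deriv0.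
    rewrite mulr1; apply: vsmallB => //.
    by apply: expansion_small_rate => //; exact: formal_solution0.
  have aj0 : 0 <= a * j.+1%:R by rewrite mulr_ge0 // ltW.
  have [d' [dD' _]] := bootstrap_step dD aj0 xD xs ds.
  by rewrite rateS; exists d'.
pose j0 := Num.bound ((\sum_i lam i) / a).
have lam_j0 i : lam i < a * j0%:R.
  rewrite mulrC -ltr_pdivrMr //; apply: le_lt_trans (archi_boundP _).
    rewrite ler_pM2r ?invr_gt0 // (bigD1 i) //= lerDl sumr_ge0 // => j _.
    exact: le_trans (ltW a0) (a_lam j).
  by rewrite divr_ge0 ?(ltW a0) // sumr_ge0 // => j _; exact: le_trans (ltW a0) (a_lam j).
have [d dD ds] := iter j0; exists d => theta.
(* beyond every eigenvalue the step no longer changes the coefficients *)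
have stay j : vsmall (a * (j0 + j).+1%:R) (fun t => x t - approx d (a * (j0 + j).+1%:R) t).
  elim: j => [|j IHj]; first by rewrite addn0.
  have aj0 : 0 <= a * (j0 + j).+1%:R by rewrite mulr_ge0 // ltW.
  have [d' [_ dd']] := bootstrap_step dD aj0 xD xs IHj.
  have -> : d' = d.
    apply/funext => i; apply: dd'; apply: lt_le_trans (lam_j0 i) _.
    by rewrite ler_pM2l // ler_nat -addnS leq_addr.
  by rewrite rateS addnS.
pose j1 := Num.bound (`|theta| / a); exists (a * (j0 + j1).+1%:R) => //.
apply: le_lt_trans (ler_norm _) _; rewrite mulrC -ltr_pdivrMr //.
apply: lt_le_trans (archi_boundP _) _; first by rewrite divr_ge0 // ltW.
by rewrite ler_nat leqW // leq_addl.
Qed.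

End Bootstrap.

(** * Exponential decay *)

Section Lyapunov.
Context {R : realType} {n : nat}.
Implicit Types (u v w : 'rV[R]_n) (A B S : 'M[R]_n).

Definition dotp u v : R := (u *m v^T) 0 0.

Lemma dotpE u v : dotp u v = \sum_s u 0 s * v 0 s.
Proof. by rewrite /dotp mxE; apply: eq_bigr => s _; rewrite mxE. Qed.

Lemma dotpC u v : dotp u v = dotp v u.
Proof. by rewrite !dotpE; apply: eq_bigr => s _; rewrite mulrC. Qed.

Lemma dotpDl u v w : dotp (u + v) w = dotp u w + dotp v w.
Proof. by rewrite /dotp mulmxDl mxE. Qed.

Lemma dotpDr u v w : dotp u (v + w) = dotp u v + dotp u w.
Proof. by rewrite ![dotp u _]dotpC dotpDl. Qed.

Lemma dotpZl (k : R) u v : dotp (k *: u) v = k * dotp u v.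
Proof. by rewrite /dotp -scalemxAl mxE. Qed.

Lemma dotpZr (k : R) u v : dotp u (k *: v) = k * dotp u v.
Proof. by rewrite dotpC dotpZl dotpC. Qed.

Lemma dotp_mul u v B : dotp (u *m B) v = dotp u (v *m B^T).
Proof. by rewrite /dotp trmx_mul trmxK mulmxA. Qed.

Lemma dotp_ge0 u : 0 <= dotp u u.
Proof. by rewrite dotpE sumr_ge0 // => s _; rewrite -expr2 sqr_ge0. Qed.

Lemma sqr_le_dotp u s : u 0 s ^+ 2 <= dotp u u.
Proof.
rewrite dotpE (bigD1 s) //= -expr2 lerDl sumr_ge0 // => j _.
by rewrite -expr2 sqr_ge0.
Qed.

Lemma dotp_amgm (al : R) u v : 0 < al -> 2 * dotp u v <= al * dotp u u + al^-1 * dotp v v.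
Proof.
move=> al0; have := dotp_ge0 (al *: u - v).
rewrite -scaleN1r !(dotpDl, dotpDr, dotpZl, dotpZr) [dotp v u]dotpC => h.
rewrite -(ler_pM2l al0) mulrDr mulVKf ?gt_eqF //; lra.
Qed.

(** Peeling the factor A - b off the list replaces S by
    1 + M (A - b) S (A - b)^T: the cross term between v and v (A - b) is
    absorbed by the form of the shorter list once M is large. *)
Lemma lyapunov_form A (al : R) (bs : seq R) : 0 < al ->
  (forall b, b \in bs -> b <= - al) ->
  exists S (be : R), [/\ S^T = S, 0 < be &
    forall v, v *m \prod_(b <- bs) (A - b%:M) = 0 ->
      dotp v v <= dotp (v *m S) v /\
      2 * dotp (v *m S) (v *m A) <= - be * dotp (v *m S) v].
Proof.
move=> al0; elim: bs => [|b bs IHbs] bs_le.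
  exists 0, 1; split=> // [|v]; first by rewrite trmx0.
  rewrite big_nil mulmx1 => ->; rewrite !mul0mx /dotp !mul0mx mxE.
  by rewrite !mulr0.
have [|S' [be' [S'T be'0 S'P]]] := IHbs.
  by move=> b' b'bs; apply: bs_le; rewrite inE b'bs orbT.
have b_le : b <= - al by apply: bs_le; rewrite mem_head.
pose B := A - b%:M; pose M := 2 / (al * be').
have M0 : 0 < M by rewrite divr_gt0 // mulr_gt0.
pose S := 1%:M + M *: (B *m S' *m B^T).
exists S, (Num.min al (be' / 2)); split=> [||v].
- by rewrite /S linearD /= trmx1 linearZ /= !trmx_mul trmxK S'T mulmxA.
- by rewrite lt_min al0 divr_gt0.
rewrite big_cons -/B -[B * _]/(B *m _) mulmxA => wP.
pose w := v *m B; have [w1 w2] := S'P w wP.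
have qE u : dotp (v *m S) u = dotp v u + M * dotp (w *m S') (u *m B).
  rewrite /S mulmxDr mulmx1 dotpDl -scalemxAr dotpZl; congr (_ + _ * _).
  by have := dotp_mul (w *m S') u B^T; rewrite trmxK => <-; rewrite !mulmxA.
have vA : v *m A = b *: v + w by rewrite /w /B mulmxBr mul_mx_scalar addrC subrK.
have vAB : v *m A *m B = w *m A.
  by rewrite -mulmxA (_ : A *m B = B *m A) ?mulmxA // /B mulmxBr mulmxBl scalar_mxC.
rewrite !qE vAB -/w {1}vA dotpDr dotpZr.
have v0 := dotp_ge0 v; have w0 := dotp_ge0 w; have cross := dotp_amgm v w al0.
have Mw : 0 <= M * dotp (w *m S') w by rewrite mulr_ge0 ?(ltW M0) // (le_trans w0).
split; first by lra.
have h1 : 2 * (b * dotp v v) <= - 2 * al * dotp v v.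
  by rewrite mulrA ler_wpM2r // -subr_ge0; lra.
have h2 : M * (2 * dotp (w *m S') (w *m A)) <= M * (- be' * dotp (w *m S') w).
  by rewrite ler_pM2l.
have h3 : al^-1 * dotp w w <= M * (be' / 2) * dotp (w *m S') w.
  rewrite (_ : M * (be' / 2) = al^-1); first by rewrite ler_pM2l ?invr_gt0.
  by rewrite /M; field; rewrite !gt_eqF.
have m1 : Num.min al (be' / 2) * dotp v v <= al * dotp v v.
  by rewrite ler_wpM2r // ge_min lexx.
have m2 : Num.min al (be' / 2) * (M * dotp (w *m S') w) <= be' / 2 * (M * dotp (w *m S') w).
  by rewrite ler_wpM2r // ge_min lexx orbT.
rewrite mulNr (mulrDr (Num.min _ _)); lra.
Qed.

Lemma is_der_dotp (y dy z dz : R -> 'rV[R]_n) (t : R) : vderiv y dy -> vderiv z dz -> 0 < t ->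
  is_derive t 1 (fun u : R => dotp (y u) (z u)) (dotp (dy t) (z t) + dotp (y t) (dz t)).
Proof.
move=> yD zD t0; rewrite !dotpE -big_split /=.
rewrite (_ : (fun _ => _) = fun u : R => \sum_s y u 0 s * z u 0 s); last first.
  by apply/funext => u; rewrite dotpE.
apply: (@is_der_sum _ _ _ _ (fun s (u : R) => y u 0 s * z u 0 s)
  (fun s (u : R) => dy u 0 s * z u 0 s + y u 0 s * dz u 0 s)) => s _.
by apply: is_der_mul; [exact: yD|exact: zD].
Qed.

Lemma dotp_bound (S : 'M[R]_n) : exists2 K, 0 <= K &
  forall u v (c : R), 0 <= c -> (forall s, `|v 0 s| <= c * \sum_j `|u 0 j|) ->
  `|dotp (u *m S) v| <= K * c * dotp u u.
Proof.
pose sg := \sum_j \sum_s `|S j s|.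
have sg0 : 0 <= sg by apply: sumr_ge0 => j _; exact: sumr_ge0.
exists (sg * (n%:R * (n%:R * n%:R))); first by rewrite !mulr_ge0.
move=> u v c c0 vc; pose X := \sum_j `|u 0 j|.
have X0 : 0 <= X by exact: sumr_ge0.
have uS s : `|(u *m S) 0 s| <= sg * X.
  rewrite mxE; apply: (le_trans (ler_norm_sum _ _ _)); rewrite mulr_sumr.
  apply: ler_sum => j _; rewrite normrM mulrC ler_wpM2r // /sg (bigD1 j) //=.
  rewrite (bigD1 s) //= -addrA lerDl addr_ge0 // ?sumr_ge0 // => i _.
  exact: sumr_ge0.
have XX : X * X <= n%:R * n%:R * dotp u u.
  rewrite /X mulr_suml -mulrA.
  have -> : n%:R * (n%:R * dotp u u) = \sum_(i < n) \sum_(j < n) dotp u u.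
    by rewrite !(sumr_const, card_ord) !mulr_natl.
  apply: ler_sum => i _; rewrite mulr_sumr; apply: ler_sum => j _.
  have := sqr_le_dotp u i; have := sqr_le_dotp u j.
  rewrite -(real_normK (num_real (u 0 i))) -(real_normK (num_real (u 0 j))) => h1 h2.
  by have := sqr_ge0 (`|u 0 i| - `|u 0 j|); rewrite sqrrB; lra.
rewrite dotpE; apply: (le_trans (ler_norm_sum _ _ _)).
apply: (@le_trans _ _ (\sum_(s < n) sg * X * (c * X))).
  by apply: ler_sum => s _; rewrite normrM; apply: ler_pM.
rewrite sumr_const card_ord -[X in X <= _]mulr_natl.
have -> : n%:R * (sg * X * (c * X)) = sg * n%:R * c * (X * X) by ring.
have -> : sg * (n%:R * (n%:R * n%:R)) * c * dotp u u =
  sg * n%:R * c * (n%:R * n%:R * dotp u u) by ring.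
by rewrite ler_wpM2l // !mulr_ge0.
Qed.

Lemma exp_small_sqr (theta : R) (h : R -> R) :
  exp_small (theta + theta) (fun t => h t ^+ 2) -> exp_small theta h.
Proof.
move=> hs r rth; have rr : r + r < theta + theta by exact: ltrD.
apply: filterS (hs _ rr) => t; rewrite normrX opprD mulrDl expRD -expr2.
by rewrite ler_pXn2r // nnegrE ?expR_ge0.
Qed.

(** The Lyapunov form W of the linear part satisfies W' <= - (be / 2) W as soon
    as x has entered a small box around 0. *)
Lemma exponential_decay A (N : 'rV[R]_n -> 'rV[R]_n) (al : R) (bs : seq R)
    (x : R -> 'rV[R]_n) :
  0 < al -> (forall b, b \in bs -> b <= - al) -> \prod_(b <- bs) (A - b%:M) = 0 ->
  Ck 2 N -> N 0 = 0 -> (forall j, partial N j 0 = 0) ->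
  vderiv x (fun t => x t *m A + N (x t)) -> x t @[t --> +oo] --> (0 : 'rV[R]_n) ->
  exists2 a, 0 < a & vsmall a x.
Proof.
move=> al0 bs_le prod0 NC2 N0 dN0 xD x0.
have [S [be [ST be0 SP]]] := lyapunov_form A al0 bs_le.
have [C [r [C0 r0 lip]]] := flat_lipschitz NC2 dN0.
have [K K0 KP] := dotp_bound S.
(* in a box of this radius, the nonlinear term uses up at most half of the
   dissipation of the Lyapunov form *)
pose rho := Num.min r (be / (4 * (K * C + 1))).
have KC1 : 0 < 4 * (K * C + 1) by rewrite mulr_gt0 // ltr_wpDl // mulr_ge0.
have rho0 : 0 < rho by rewrite lt_min r0 divr_gt0.
have rhor : rho <= r by rewrite ge_min lexx.
have Krho : K * (C * rho) <= be / 4.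
  have h : rho * (4 * (K * C + 1)) <= be by rewrite -ler_pdivlMr // ge_min lexx orbT.
  have e : rho * (4 * (K * C + 1)) = 4 * (K * (C * rho)) + 4 * rho by ring.
  by rewrite e in h; lra.
have /near_pinftyP[T [T0 xT]] : \forall t \near +oo, in_box 0 rho (x t).
  have H : \forall z \near (0 : 'rV[R]_n), in_box 0 rho z by apply/in_box_nbhs; exists rho.
  exact: (x0 _ H).
pose W t := dotp (x t *m S) (x t).
have W1 t : dotp (x t) (x t) <= W t by have [] := SP (x t) (etrans (congr1 (mulmx _) prod0) (mulmx0 _ _)).
have WD (t : R) : 0 < t -> is_derive t 1 W (2 * dotp (x t *m S) (x t *m A + N (x t))).
  move=> t0; apply: is_der_eq (is_der_dotp (vderiv_mul S xD) xD t0) _.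
  by rewrite dotp_mul ST dotpC mulr_natl mulr2n.
have WB (t : R) : T < t -> 2 * dotp (x t *m S) (x t *m A + N (x t)) <= - (be / 2) * W t.
  move=> Tt; have [_ h1] := SP (x t) (etrans (congr1 (mulmx _) prod0) (mulmx0 _ _)).
  have zero_box : in_box 0 rho (0 : 'rV[R]_n) by move=> j; rewrite subrr normr0 ltW.
  have h2 := KP (x t) (N (x t)) (C * rho) (mulr_ge0 C0 (ltW rho0)) _.
  have {}h2 := h2 (fun s => _).
  have h3 : `|dotp (x t *m S) (N (x t))| <= be / 4 * dotp (x t) (x t).
    apply: le_trans (h2 _) _; last by rewrite ler_wpM2r // dotp_ge0.
    move=> s; have := lip rho (x t) 0 (ltW rho0) rhor (xT t (ltW Tt)) zero_box s.
    rewrite N0 !mxE subr0; under eq_bigr do rewrite mxE subr0.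
    by [].
  have h4 : be / 4 * dotp (x t) (x t) <= be / 4 * W t by rewrite ler_wpM2l // divr_ge0 // ltW.
  have h5 := ler_norm (dotp (x t *m S) (N (x t))).
  by rewrite -/(W t) in h1; rewrite dotpDr mulrDr; lra.
have ED (t : R) : T < t -> is_derive t 1 (fun u : R => expR (be / 2 * u) * W u)
    (expR (be / 2 * t) * (be / 2 * W t + 2 * dotp (x t *m S) (x t *m A + N (x t)))).
  move=> Tt; apply: is_der_eq (is_der_mul (is_der_expR _ _) (WD t (lt_trans T0 Tt))) _.
  by rewrite /=; ring.
have EB (t : R) : T < t ->
    expR (be / 2 * t) * (be / 2 * W t + 2 * dotp (x t *m S) (x t *m A + N (x t))) <= 0.
  move=> Tt; rewrite pmulr_rle0 ?expR_gt0 //; have := WB t Tt; lra.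
have T1 : T < T + 1 by rewrite ltrDl.
have Wmono := is_der_nincr ED EB T1.
pose W0 := expR (be / 2 * (T + 1)) * W (T + 1).
have WS : exp_small (be / 2) W.
  apply: (exp_small_dom _ (exp_smallZ W0 (exp_small_expR (be / 2)))).
  apply/near_pinftyP; exists (T + 1); split; first by rewrite addr_gt0.
  move=> t /Wmono h; have Wge t' : 0 <= W t' by apply: le_trans (W1 t'); exact: dotp_ge0.
  rewrite ger0_norm // ger0_norm ?mulr_ge0 ?expR_ge0 //.
  by rewrite mulNr expRN ler_pdivlMr ?expR_gt0 // mulrC.
exists (be / 4); first by rewrite divr_gt0.
move=> s; apply: exp_small_sqr; rewrite (_ : be / 4 + be / 4 = be / 2); last by field.
apply: exp_small_dom WS; near=> t.
rewrite ger0_norm ?sqr_ge0 //; apply: le_trans (ler_norm _).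
exact: le_trans (sqr_le_dotp _ _) (W1 t).
Unshelve. all: by end_near. Qed.

End Lyapunov.

(** * Spectrum and uniqueness of solutions *)

Section Spectrum.
Context {R : realType}.

(** Over the complex numbers the characteristic polynomial splits, and all its
    roots are real. *)
Lemma real_spectrum_split n (L : 'M[R]_n.+1) :
  (forall z : R[i], eigenvalue (map_mx (real_complex R) L) z -> complex.Im z = 0) ->
  exists2 bs : seq R, char_poly L = \prod_(b <- bs) ('X - b%:P) &
    forall b, b \in bs -> eigenvalue L b.
Proof.
move=> Lreal; pose p := char_poly (map_mx (real_complex R) L).
have [zs zsE] := closed_field_poly_normal p.
have p_monic : lead_coef p = 1 by apply/monicP; exact: char_poly_monic.
rewrite p_monic scale1r in zsE.
have zs_real z : z \in zs -> z = real_complex R (complex.Re z).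
  move=> zzs; have : eigenvalue (map_mx (real_complex R) L) z.
    by rewrite eigenvalue_root_char -/p zsE root_prod_XsubC.
  by move/Lreal; case: z {zzs} => u v /= ->.
pose bs := [seq complex.Re z | z <- zs].
have bsE : char_poly L = \prod_(b <- bs) ('X - b%:P).
  apply: (map_poly_inj (real_complex R)); rewrite map_char_poly -/p zsE.
  rewrite rmorph_prod big_map /=; apply: eq_big_seq => z /zs_real zE.
  by rewrite map_polyXsubC {1}zE.
exists bs => // b bbs.
by rewrite eigenvalue_root_char bsE root_prod_XsubC.
Qed.

Lemma char_poly_tr n (L : 'M[R]_n) : char_poly L^T = char_poly L.
Proof.
rewrite /char_poly -[RHS]det_tr; congr (\det _).
by apply/matrixP => i j; rewrite !mxE eq_sym.
Qed.

Lemma split_annihilates n m (A : 'M[R]_n.+1) (lam : 'I_m -> R) (bs : seq R) :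
  char_poly A = \prod_(b <- bs) ('X - b%:P) ->
  (forall b, b \in bs -> exists i, b = - lam i) ->
  \prod_(b <- bs) (A - b%:M) = 0 /\
  horner_mx A (\prod_(i <- enum 'I_m) ('X - (- lam i)%:P) ^+ size bs) = 0.
Proof.
move=> AE bs_lam; have CH := Cayley_Hamilton A; rewrite AE in CH; split.
  rewrite -[RHS]CH rmorph_prod; apply: eq_bigr => b _.
  by rewrite rmorphB /= horner_mx_X horner_mx_C.
have : \prod_(b <- bs) ('X - b%:P) %| \prod_(i <- enum 'I_m) ('X - (- lam i)%:P) ^+ size bs.
  elim: bs bs_lam {AE CH} => [|b bs IHbs] bs_lam; first by rewrite big_nil dvd1p.
  rewrite big_cons /=; under [X in _ %| X]eq_bigr do rewrite exprS.
  rewrite big_split /=; apply: dvdp_mul; last first.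
    by apply: IHbs => b' b'bs; apply: bs_lam; rewrite inE b'bs orbT.
  have [i ->] := bs_lam b (mem_head _ _).
  by rewrite (bigD1_seq i) ?mem_enum ?enum_uniq //= dvdp_mulr.
move=> /dvdpP[q ->].
by rewrite rmorphM /= CH mulr0.
Qed.

End Spectrum.

Section Uniqueness.
Context {R : realType} {n : nat}.

Lemma vderiv_is_derive (x dx : R -> 'rV[R]_n) :
  (forall t : R, 0 < t -> is_derive t 1 x (dx t)) -> vderiv x dx.
Proof.
move=> xD t t0 s; have [xd xE] := xD t t0.
apply: DeriveDef; first exact: ((derivable_mxP _ _ _).1 xd).
by rewrite -xE derive_mx // mxE.
Qed.

Lemma within_coord_le (x : R -> 'rV[R]_n) (tau e : R) :
  {within `[0, +oo[, continuous x} -> 0 <= tau -> 0 < e ->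
  exists2 de, 0 < de & forall t, 0 <= t -> `|t - tau| < de -> in_box (x tau) e (x t).
Proof.
move=> /subspace_continuousP xc tau0 e0.
have tauI : `[0, +oo[%classic tau by rewrite /= in_itv /= tau0.
have := xc _ tauI; move/cvgrPdist_le => /(_ e e0) /nbhs_ballP[de /= de0 deP].
exists de => // t t0 tde s.
have : `|x tau - x t| <= e.
  by apply: deP; rewrite /= ?in_itv /= ?t0 // /ball /= distrC.
by apply: le_trans; have := rV_norm_ge (x tau - x t) s; rewrite !mxE distrC.
Qed.

Lemma within_coord2_le (x y : R -> 'rV[R]_n) (tau e : R) :
  {within `[0, +oo[, continuous x} -> {within `[0, +oo[, continuous y} -> 0 <= tau -> 0 < e ->
  exists2 de, 0 < de & forall t, 0 <= t -> `|t - tau| < de ->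
    in_box (x tau) e (x t) /\ in_box (y tau) e (y t).
Proof.
move=> xc yc tau0 e0.
have [d1 d10 d1P] := within_coord_le xc tau0 e0.
have [d2 d20 d2P] := within_coord_le yc tau0 e0.
exists (Num.min d1 d2); first by rewrite lt_min d10.
by move=> t t0; rewrite lt_min => /andP[t1 t2]; split; [exact: d1P|exact: d2P].
Qed.

(** The function exp(- c t) W decreases on the right of tau, where it starts from
    0. As W need not be differentiable at tau = 0, its starting value enters
    through the smallness of W immediately after tau. *)
Lemma gronwall_right (W dW : R -> R) (tau de c : R) : 0 <= tau -> 0 <= c ->
  (forall t : R, 0 < t -> is_derive t 1 W (dW t)) ->
  (forall t, tau < t -> t < tau + de -> dW t <= c * W t) ->
  (forall e, 0 < e -> exists2 d, 0 < d & forall t, tau < t -> t < tau + d -> W t <= e) ->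
  forall t, tau < t -> t < tau + de -> W t <= 0.
Proof.
move=> tau0 c0 WD WB W_small t taut tde.
pose E t := expR (- c * t) * W t.
have ED (u : R) : 0 < u -> is_derive u 1 E (expR (- c * u) * (- c * W u + dW u)).
  move=> u0; apply: is_der_eq (is_der_mul (is_der_expR _ _) (WD u u0)) _.
  by rewrite /=; ring.
have Emono s : tau < s -> s <= t -> E t <= E s.
  move=> taus st; have s0 : 0 < s by exact: le_lt_trans taus.
  have Ec : {within `[s, t], continuous E}.
    apply: derivable_within_continuous => u; rewrite in_itv /= => /andP[su _].
    by have ? := ED u (lt_le_trans s0 su); exact: ex_derive.
  have ED' u : u \in `]s, t[ -> is_derive u 1 E (expR (- c * u) * (- c * W u + dW u)).
    by rewrite in_itv /= => /andP[su _]; apply: ED; exact: lt_trans su.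
  have [u + EE] := MVT_segment st ED' Ec; rewrite in_itv /= => /andP[su ut].
  rewrite -subr_le0 EE mulr_le0_ge0 ?subr_ge0 // pmulr_rle0 ?expR_gt0 //.
  by rewrite mulNr addrC subr_le0; apply: WB; [exact: lt_le_trans su|exact: le_lt_trans tde].
rewrite -(pmulr_rle0 _ (expR_gt0 (- c * t))) -/(E t); apply/ler_addgt0Pr => e e0.
rewrite add0r; have [d d0 dP] := W_small e e0.
pose q := Num.min (t - tau) (d / 2).
have q0 : 0 < q by rewrite lt_min subr_gt0 taut divr_gt0.
have q1 : q <= t - tau by rewrite ge_min lexx.
have q2 : q < d by apply: (@le_lt_trans _ _ (d / 2)); [rewrite ge_min lexx orbT|lra].
have taus : tau < tau + q by rewrite ltrDl.
have st : tau + q <= t by rewrite addrC -lerBrDr.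
have sd : tau + q < tau + d by rewrite ltrD2l.
apply: le_trans (Emono _ taus st) _; have We := dP _ taus sd.
have [W0|W0] := leP (W (tau + q)) 0.
  by apply: le_trans (ltW e0); rewrite mulr_ge0_le0 ?expR_ge0.
apply: le_trans We; rewrite ler_piMl ?(ltW W0) // -expR0 ler_expR mulNr oppr_le0.
by rewrite mulr_ge0 // addr_ge0 // ltW.
Qed.

(** Gronwall's inequality for the squared distance, with a local Lipschitz
    constant of N around the common value at tau. *)
Lemma solution_unique_right (A : 'M[R]_n) (N : 'rV[R]_n -> 'rV[R]_n)
    (x y : R -> 'rV[R]_n) (tau : R) :
  Ck 1 N -> solution (fun p => p *m A + N p) x -> solution (fun p => p *m A + N p) y ->
  0 <= tau -> x tau = y tau ->
  exists2 de, 0 < de & forall t, tau < t -> t < tau + de -> x t = y t.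
Proof.
move=> NC1 [xc /vderiv_is_derive xD] [yc /vderiv_is_derive yD] tau0 xy_tau.
have [C [r [C0 r0 lip]]] := C1_locally_lipschitz (x tau) NC1.
have [de de0 deP] := within_coord2_le xc yc tau0 r0.
have [K K0 KP] := dotp_bound (1%:M : 'M[R]_n).
have [K' K'0 K'P] := dotp_bound A.
pose w t := x t - y t; pose W t := dotp (w t) (w t).
have after t d : tau < t -> t < tau + d -> 0 <= t /\ `|t - tau| < d.
  by move=> taut td; rewrite (le_trans tau0) ?ltW // gtr0_norm ?subr_gt0 // ltrBlDl.
have wD : vderiv w (fun t => w t *m A + (N (x t) - N (y t))).
  by apply: vderiv_eq (vderivB xD yD) _ => t _; rewrite mulmxBl opprD addrACA.
have WD (t : R) : 0 < t -> is_derive t 1 W (2 * dotp (w t) (w t *m A + (N (x t) - N (y t)))).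
  move=> t0; apply: is_der_eq (is_der_dotp wD wD t0) _.
  by rewrite dotpC mulr_natl mulr2n.
have WB t : tau < t -> t < tau + de ->
    2 * dotp (w t) (w t *m A + (N (x t) - N (y t))) <= 2 * (K' + K * C) * W t.
  move=> taut tde; have [t0 tn] := after _ _ taut tde.
  have [xb yb] := deP t t0 tn; rewrite -xy_tau in yb.
  have h1 : `|dotp (w t *m 1%:M) (N (x t) - N (y t))| <= K * C * W t.
    apply: KP => // s; rewrite rV_subE; under eq_bigr do rewrite rV_subE.
    by apply: lip; [exact: xb|exact: yb].
  have h2 : `|dotp (w t *m A) (w t)| <= K' * 1 * W t.
    by apply: K'P => // s; rewrite mul1r (bigD1 s) //= lerDl sumr_ge0.
  rewrite mulmx1 in h1; rewrite dotpC mulr1 in h2.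
  rewrite dotpDr -mulrA ler_pM2l // mulrDl; apply: lerD.
    exact: le_trans (ler_norm _) h2.
  exact: le_trans (ler_norm _) h1.
have W_small (e : R) : 0 < e -> exists2 d, 0 < d & forall t, tau < t -> t < tau + d -> W t <= e.
  move=> e0; pose e' := Num.min 1 (e / (n%:R * 4 + 1)).
  have n40 : 0 < n%:R * 4 + 1 :> R by rewrite ltr_wpDl // mulr_ge0.
  have e'0 : 0 < e' by rewrite lt_min ltr01 divr_gt0.
  have e'1 : e' <= 1 by rewrite ge_min lexx.
  have e'e : e' * (n%:R * 4 + 1) <= e by rewrite -ler_pdivlMr // ge_min lexx orbT.
  have [d d0 dP] := within_coord2_le xc yc tau0 e'0; exists d => // t taut td.
  have [t0 tn] := after _ _ taut td; have [xb yb] := dP t t0 tn.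
  rewrite -xy_tau in yb.
  have wb s : w t 0 s * w t 0 s <= 4 * e'.
    have h : `|w t 0 s| <= e' + e'.
      rewrite rV_subE -(subrKA (x tau 0 s)) (le_trans (ler_normD _ _)) //.
      by apply: lerD; [exact: xb|rewrite distrC; exact: yb].
    rewrite -expr2 -real_normK ?num_real // expr2.
    apply: (@le_trans _ _ ((e' + e') * 2)).
      by apply: ler_pM => //; apply: le_trans h _; apply: lerD.
    by rewrite le_eqVlt; apply/orP; left; apply/eqP; ring.
  rewrite /W dotpE; apply: (@le_trans _ _ (\sum_(s < n) 4 * e')).
    by apply: ler_sum => s _; exact: wb.
  rewrite sumr_const card_ord -[leLHS]mulr_natl; apply: le_trans e'e.
  by rewrite (_ : n%:R * (4 * e') = e' * (n%:R * 4)) ?ler_pM2l ?lerDl //; ring.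
exists de => // t taut tde; have c0 : 0 <= 2 * (K' + K * C).
  by rewrite mulr_ge0 // addr_ge0 // mulr_ge0.
have Wt0 := gronwall_right tau0 c0 WD WB W_small taut tde.
apply/rowP => s; apply/eqP; rewrite -subr_eq0 -rV_subE -sqrf_eq0 eq_le sqr_ge0 andbT.
exact: le_trans (sqr_le_dotp _ _) Wt0.
Qed.

(** The supremum of the times up to which the two solutions agree would be a
    time from which they still agree a little longer. *)
Lemma solution_unique (A : 'M[R]_n) (N : 'rV[R]_n -> 'rV[R]_n) (x y : R -> 'rV[R]_n) :
  Ck 1 N -> solution (fun p => p *m A + N p) x -> solution (fun p => p *m A + N p) y ->
  x 0 = y 0 -> forall t, 0 <= t -> x t = y t.
Proof.
move=> NC1 xS yS xy0 t1 t10; have [xc _] := xS; have [yc _] := yS.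
apply: contrapT => xy1.
pose Z := [set T : R | 0 <= T /\ forall t, 0 <= t -> t <= T -> x t = y t].
have Z0 : Z 0.
  by split=> // t t0 tle; have -> : t = 0 by apply/eqP; rewrite eq_le t0 tle.
have supZ : has_sup Z.
  split; first by exists 0.
  by exists t1 => T [_ ZT]; rewrite leNgt; apply/negP => /ltW h; apply: xy1; exact: ZT.
pose tau := sup Z.
have tau0 : 0 <= tau by apply: ub_le_sup => //; case: supZ.
have below t : 0 <= t -> t < tau -> x t = y t.
  move=> t0 /(sup_gt supZ.1)[T [_ ZT] tT]; apply: ZT => //; exact: ltW.
have xy_tau : x tau = y tau.
  apply/rowP => s; apply/eqP; rewrite -subr_eq0 -normr_le0; apply/ler_addgt0Pr => e e0.
  rewrite add0r; have e2 : 0 < e / 2 by rewrite divr_gt0.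
  have [d d0 dP] := within_coord2_le xc yc tau0 e2.
  have [T [T0 ZT] Ttau] := sup_adherent d0 supZ.
  have TZ : T <= tau by apply: ub_le_sup; [case: supZ|].
  have Td : `|T - tau| < d.
    by rewrite distrC ger0_norm ?subr_ge0 // ltrBlDr -ltrBlDl.
  have [/(_ s) h1 /(_ s) h2] := dP T T0 Td; rewrite -(ZT T) // in h2.
  rewrite -(subrKA (x T 0 s)) (le_trans (ler_normD _ _)) // [e]splitr.
  by apply: lerD => //; rewrite distrC.
have [de de0 deP] := solution_unique_right NC1 xS yS tau0 xy_tau.
have Ztau : Z (tau + de / 2).
  split=> [|t t0 tle]; first by rewrite addr_ge0 // divr_ge0 // ltW.
  have [/below -> //|taut|->//] := ltgtP t tau.
  by apply: deP => //; apply: le_lt_trans tle _; rewrite ltrD2l gtr_pMr // invf_lt1 // ltr1n.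
have := ub_le_sup supZ.2 Ztau; rewrite -/tau leNgt ltrDl divr_gt0 //.
Qed.

End Uniqueness.

(** * The expansion theorem *)

Section Assembly.
Context {R : realType} {m n : nat}.

Lemma partial_at_zero (N : 'rV[R]_n -> 'rV[R]_n) : Ck 1 N -> 'J N 0 = 0 ->
  forall j, partial N j 0 = 0.
Proof.
move=> NC1 JN0 j; rewrite /partial deriveEjacobian ?JN0 ?mulmx0 //.
exact: C1_differentiable.
Qed.

(** The shift A + mu is annihilated by the shifted list of eigenvalues. *)
Lemma shifted_inverse (A : 'M[R]_n) (bs : seq R) : \prod_(b <- bs) (A - b%:M) = 0 ->
  exists inv : R -> 'rV[{poly R}]_n -> 'rV[{poly R}]_n,
    forall mu F, pderiv (inv mu F) = inv mu F *m (A + mu%:M)^P + F.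
Proof.
move=> prod0.
have /choice[inv invP] : forall p : R * 'rV[{poly R}]_n, exists c : 'rV[{poly R}]_n,
    pderiv c = c *m (A + p.1%:M)^P + p.2.
  move=> [mu F] /=; apply: (pderiv_sub_surj (bs := [seq b + mu | b <- bs])).
  rewrite big_map -[RHS]prod0; apply: eq_bigr => b _.
  by rewrite raddfD /= opprD addrACA [mu%:M - _]subrr addr0.
by exists (fun mu F => inv (mu, F)) => mu F; rewrite invP.
Qed.

End Assembly.

Section PositiveDimension.
Context {R : realType} {n m : nat}.
Variables (L : 'M[R]_n.+1) (N : 'rV[R]_n.+1 -> 'rV[R]_n.+1) (lam : 'I_m -> R).
Hypotheses (N_smooth : smooth N) (N0 : N 0 = 0) (JN0 : 'J N 0 = 0).
Hypothesis L_spectrum : forall z : R[i], eigenvalue (map_mx (real_complex R) L) z ->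
  complex.Im z = 0 /\ complex.Re z < 0.
Hypothesis lamP : forall a : R, eigenvalue L a <-> exists i : 'I_m, a = - lam i.
Hypothesis lam_sorted : forall i j : 'I_m, (i < j)%N -> - lam j < - lam i.

Lemma lam_gt0 i : 0 < lam i.
Proof.
have : eigenvalue L (- lam i) by apply/lamP; exists i.
rewrite eigenvalue_root_char => rt.
have : eigenvalue (map_mx (real_complex R) L) (real_complex R (- lam i)).
  by rewrite eigenvalue_root_char -map_char_poly /root horner_map (eqP rt) rmorph0.
by move=> /L_spectrum[_] /=; rewrite oppr_lt0.
Qed.

Lemma lam_inj : injective lam.
Proof.
move=> i j E; apply: val_inj; have [/lam_sorted|/lam_sorted|//] := ltngtP i j.
  by rewrite E ltxx.
by rewrite E ltxx.
Qed.

Lemma lam_lower_bound : exists2 al, 0 < al & forall i, al <= lam i.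
Proof.
exists (\big[Num.min/1]_i lam i); first by apply: lt_bigmin => // i _; exact: lam_gt0.
by move=> i; exact: bigmin_le_cond.
Qed.

Lemma decaying_solution_expansion :
  exists inv : R -> 'rV[{poly R}]_n.+1 -> 'rV[{poly R}]_n.+1,
  forall x, decaying_solution L N x ->
  exists d, forall theta, exists2 theta', theta < theta' &
    vsmall theta' (fun t => x t - expansion lam (formal_solution lam N inv d) theta' t).
Proof.
have [bs bsE bs_eig] := real_spectrum_split (fun z zL => (L_spectrum zL).1).
have bs_lam b : b \in bs -> exists i, b = - lam i by move=> /bs_eig/lamP.
have AE : char_poly L^T = \prod_(b <- bs) ('X - b%:P) by rewrite char_poly_tr.
have [prod0 A_split] := split_annihilates AE bs_lam.
have [inv invP] := shifted_inverse prod0.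
have [al al0 al_lam] := lam_lower_bound.
have dN0 := partial_at_zero (N_smooth 1) JN0.
exists inv => x [[_ /vderiv_is_derive xD] x0].
have bs_le b : b \in bs -> b <= - al by move=> /bs_lam[i ->]; rewrite lerN2.
have [a1 a10 xs] := exponential_decay al0 bs_le prod0 (N_smooth 2) N0 dN0 xD x0.
pose a := Num.min a1 al; have a0 : 0 < a by rewrite lt_min a10.
have a_lam i : a <= lam i by apply: le_trans (al_lam i); rewrite ge_min lexx orbT.
apply: (bootstrap a0 a_lam lam_inj N_smooth N0 dN0 invP A_split xD).
by apply: vsmall_le xs; rewrite ge_min lexx.
Qed.

Lemma expansion_positive_dimension :
  exists c : (R -> 'rV[R]_n.+1) -> multi_index m -> 'rV[{poly R}]_n.+1,
    let d x i := c x (mi_unit i) in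
    [/\ forall x, decaying_solution L N x ->
          forall Theta : R, 0 < Theta -> forall s : 'I_n.+1,
          o_exp Theta (fun t => x t 0 s -
            \sum_(chi \in I_ lam Theta)
              (c x chi 0 s).[t] * expR (- mi_dot lam chi * t)),
        forall x y, decaying_solution L N x -> decaying_solution L N y ->
          x 0 = y 0 -> forall i, d x i = d y i,
        forall x y, decaying_solution L N x -> decaying_solution L N y ->
          (forall i, d x i = d y i) ->
          forall chi, (1 < mi_size chi)%N -> c x chi = c y chi
      & forall x y, decaying_solution L N x -> decaying_solution L N y ->
          forall i : 'I_m, (forall j : 'I_m, (j <= i)%N -> d x j = d y j) ->
          forall chi : multi_index m, (forall j : 'I_m, (i < j)%N -> chi j = 0%N) ->
          c x chi = c y chi].
Proof.
have [inv invP] := decaying_solution_expansion.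
have [al al0 al_lam] := lam_lower_bound.
pose good x d := forall theta, exists2 theta', theta < theta' &
    vsmall theta' (fun t => x t - expansion lam (formal_solution lam N inv d) theta' t).
(* d is attached to the initial value rather than to the solution *)
have /choice[D DP] : forall p, exists d, forall x, decaying_solution L N x -> x 0 = p -> good x d.
  move=> p; have [[y [yS y0]]|none] := pselect (exists y, decaying_solution L N y /\ y 0 = p).
    have [d dP] := invP y yS; exists d => x xS x0 theta.
    have [theta' th ds] := dP theta; exists theta' => //.
    apply: vsmall_eq ds => t t0; congr (_ - _).
    apply: (solution_unique (N_smooth 1) xS.1 yS.1) (ltW t0).
    by rewrite x0 y0.
  by exists (fun=> 0) => x xS x0; case: none; exists x.
exists (fun x => formal_solution lam N inv (D (x 0))) => d.
have dE x i : d x i = D (x 0) i by exact: formal_solution_unit.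
split=> [x xS Theta Theta0 s|x y _ _ xy i|x y _ _ dxy chi _|x y _ _ i dxy chi chi0].
- have [theta' th xs] := DP _ x xS erefl Theta.
  apply: o_exp_ext (o_expD (exp_small_o_exp th (xs s))
    (expansion_trunc_o_exp al0 al_lam (formal_solution lam N inv (D (x 0))) s (ltW th))) => t.
  by rewrite -(expansionE al0 al_lam) !rV_subE addrA subrK.
- by rewrite !dE xy.
- by apply: formal_solution_supp => i _; rewrite -!dE.
- apply: formal_solution_supp => j chi_j; rewrite -!dE; apply: dxy.
  by rewrite leqNgt; apply/negP => /chi0 E; rewrite E in chi_j.
Qed.

End PositiveDimension.

Theorem propositionA14 (R : realType) (n : nat) (L : 'M[R]_n)
    (N : 'rV[R]_n -> 'rV[R]_n) (m : nat) (lam : 'I_m -> R)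
    (N_smooth : smooth N) (N0 : N 0 = 0) (JN0 : 'J N 0 = 0)
    (L_spectrum : forall z : R[i], eigenvalue (map_mx (real_complex R) L) z ->
       complex.Im z = 0 /\ complex.Re z < 0)
    (lamP : forall a : R, eigenvalue L a <-> exists i : 'I_m, a = - lam i)
    (lam_sorted : forall i j : 'I_m, (i < j)%N -> - lam j < - lam i) :
  exists c : (R -> 'rV[R]_n) -> multi_index m -> 'rV[{poly R}]_n,
    let d x i := c x (mi_unit i) in
    [/\ forall x, decaying_solution L N x ->
          forall Theta : R, 0 < Theta -> forall s : 'I_n,
          o_exp Theta (fun t => x t 0 s -
            \sum_(chi \in I_ lam Theta)
              (c x chi 0 s).[t] * expR (- mi_dot lam chi * t)),
        forall x y, decaying_solution L N x -> decaying_solution L N y ->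
          x 0 = y 0 -> forall i, d x i = d y i,
        forall x y, decaying_solution L N x -> decaying_solution L N y ->
          (forall i, d x i = d y i) ->
          forall chi, (1 < mi_size chi)%N -> c x chi = c y chi
      & forall x y, decaying_solution L N x -> decaying_solution L N y ->
          forall i : 'I_m, (forall j : 'I_m, (j <= i)%N -> d x j = d y j) ->
          forall chi : multi_index m, (forall j : 'I_m, (i < j)%N -> chi j = 0%N) ->
          c x chi = c y chi].
Proof.
case: n L N N_smooth N0 JN0 L_spectrum lamP => [|n'] L' N' *.
  by exists (fun _ _ => 0); split=> // x _ Theta _ [].
exact: expansion_positive_dimension.
Qed.
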